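(* Let $d\ge2$. The enveloping group $\mathcal{G}(\mathfrak{S}_d^{\mathrm{geo}})$ of $\mathfrak{S}_d^{\mathrm{geo}}$ coincides with the index $2$ subgroup of $\mathbb{Z}\times\mathfrak{S}_d$ of pairs $(r,\sigma)$ such that $r$ and $\sigma$ have the same parity. The PMQ completion $\widehat{\mathfrak{S}_d^{\mathrm{geo}}}$ of $\mathfrak{S}_d^{\mathrm{geo}}$ is the set of all sequences $$(\sigma;\mathfrak{P}_1,\dots,\mathfrak{P}_\ell;r_1,\dots,r_\ell),$$ consisting of a permutation $\sigma\in\mathfrak{S}_d$, an unordered partition $\mathfrak{P}_1,\dots,\mathfrak{P}_\ell$ of the set $\{1,\dots,d\}$, and a system of integer weights $r_1,\dots,r_\ell\ge0$ on the pieces of the partition, satisfying the following properties: 1. $\sigma$ preserves each piece $\mathfrak{P}_j$ of the partition; 2. $r_j+2-|\mathfrak{P}_j|$ is greater than or equal to the number of cycles of the restricted permutation $\sigma|_{\mathfrak{P}_j}\in\mathfrak{S}_{\mathfrak{P}_j}$, for all $1\le j\le\ell$; 3. $r_j$ has the same parity as the restricted permutation $\sigma|_{\mathfrak{P}_j}\in\mathfrak{S}_{\mathfrak{P}_j}$, for all $1\le j\le\ell$.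
   Context: A quandle (with unit) is a set $\mathcal{Q}$ with an element $\mathbf{1}$ and an operation $(a,b)\mapsto a^b$ (conjugation) such that: $(-)^a$ is bijective for all $a$; $\mathbf{1}^a=\mathbf{1}$ and $a^{\mathbf{1}}=a$; $a^a=a$; $(a^b)^c=(a^c)^{(b^c)}$. A partial monoid is a set $M$ with an element $\mathbf{1}$ and a partially defined product such that $\mathbf{1}a$, $a\mathbf{1}$ are defined and equal to $a$, and for all $a,b,c$: ($ab$ and $(ab)c$ are defined) iff ($bc$ and $a(bc)$ are defined), in which case $(ab)c=a(bc)$. A partially multiplicative quandle (PMQ) is a set $\mathcal{Q}$ that is both, with the same unit, such that: $ab$ is defined iff $b(a^b)$ is, and then they are equal; $a^{(bc)}=(a^b)^c$ whenever $bc$ is defined; $ab$ is defined iff $(a^c)(b^c)$ is, and then $(ab)^c=(a^c)(b^c)$. Maps of PMQs preserve unit, conjugation and defined products. A PMQ is complete if all products are defined. For a finite set $S$, $\mathfrak{S}_S$ is the group of permutations of $S$, and $\mathfrak{S}_d=\mathfrak{S}_{\{1,\dots,d\}}$. For a permutation $\sigma$, $N(\sigma)$ is the minimal $m\ge0$ such that $\sigma$ is a product of $m$ transpositions; the parity of $\sigma$ is the parity of $N(\sigma)$. Fixed points count as cycles of length $1$. $\mathfrak{S}_d^{\mathrm{geo}}$ is the PMQ with underlying set $\mathfrak{S}_d$, unit the identity, conjugation $\sigma^\tau=\tau^{-1}\sigma\tau$, and product $\sigma\tau$ (the group product) defined if and only if $N(\sigma\tau)=N(\sigma)+N(\tau)$.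 The enveloping group $\mathcal{G}(\mathcal{Q})$ of a PMQ $\mathcal{Q}$ is the group with generators $[a]$, $a\in\mathcal{Q}$, and relations $[b]^{-1}[a][b]=[a^b]$ for all $a,b$, and $[a][b]=[ab]$ whenever $ab$ is defined. The completion $\hat{\mathcal{Q}}$ is the initial complete PMQ receiving a map of PMQs from $\mathcal{Q}$; as a monoid it is generated by $\hat a$, $a\in\mathcal{Q}$, with relations $\hat{\mathbf{1}}=\mathbf{1}$, $\hat a\hat b=\widehat{ab}$ when $ab$ is defined, and $\hat a\hat b=\hat b\,\widehat{a^b}$ for all $a,b$. Each weight $r_j$ is attached to the piece $\mathfrak{P}_j$.
   Formalization: The sequences must also satisfy that each piece with exactly one element has weight 0; conditions 1–3 alone allow any even weight there, e.g. (id;{1},{2};2,0) for d=2, which matches no element of the completion. *)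

(* Defs.v *)
From HB Require Import structures.
From mathcomp Require Import all_boot all_order all_algebra all_fingroup.
From mathcomp Require Import generic_quotient boolp.
Set Implicit Arguments.
Unset Strict Implicit.
Unset Printing Implicit Defensive.
Import GRing.Theory.
Local Open Scope group_scope.

(* A partial product is an [option]-valued operation, [None] standing for
   "undefined".  An equation between [option]s therefore says that one side is
   defined iff the other one is, and that they then agree. *)
Record is_quandle (Q : Type) (e : Q) (conj : Q -> Q -> Q) : Prop := IsQuandle {
  quandle_bij : forall a, bijective (conj^~ a);
  quandle_conj1 : forall a, conj e a = e;
  quandle_1conj : forall a, conj a e = a;
  quandle_idem : forall a, conj a a = a;
  quandle_distr : forall a b c,
    conj (conj a b) c = conj (conj a c) (conj b c) }.

Record is_pmonoid (Q : Type) (e : Q) (mul : Q -> Q -> option Q) : Prop :=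
  IsPMonoid {
  pmonoid_1mul : forall a, mul e a = Some a;
  pmonoid_mul1 : forall a, mul a e = Some a;
  pmonoid_assoc : forall a b c,
    obind (fun ab => mul ab c) (mul a b) = obind (fun bc => mul a bc) (mul b c)
}.

Record pmq := PMQ {
  pmq_sort :> Type;
  pmq_one : pmq_sort;
  pmq_conj : pmq_sort -> pmq_sort -> pmq_sort;
  pmq_mul : pmq_sort -> pmq_sort -> option pmq_sort;
  pmq_quandle : is_quandle pmq_one pmq_conj;
  pmq_pmonoid : is_pmonoid pmq_one pmq_mul;
  pmq_mul_swap : forall a b, pmq_mul a b = pmq_mul b (pmq_conj a b);
  pmq_conj_mul : forall a b c bc, pmq_mul b c = Some bc ->
    pmq_conj a bc = pmq_conj (pmq_conj a b) c;
  pmq_mul_conj : forall a b c,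
    pmq_mul (pmq_conj a c) (pmq_conj b c) =
      omap (pmq_conj^~ c) (pmq_mul a b) }.

Record is_pmq_map (Q R : pmq) (f : Q -> R) : Prop := IsPMQMap {
  pmq_map1 : f (pmq_one Q) = pmq_one R;
  pmq_mapJ : forall a b, f (pmq_conj a b) = pmq_conj (f a) (f b);
  pmq_mapM : forall a b ab, pmq_mul a b = Some ab ->
    pmq_mul (f a) (f b) = Some (f ab) }.

Definition pmq_complete (Q : pmq) : Prop :=
  forall a b : Q, exists c, pmq_mul a b = Some c.

Record is_completion (Q C : pmq) (i : Q -> C) : Prop := IsCompletion {
  completion_complete : pmq_complete C;
  completion_map : is_pmq_map i;
  completion_init : forall (D : pmq) (g : Q -> D),
    pmq_complete D -> is_pmq_map g ->
    exists h : C -> D, [/\ is_pmq_map h, h \o i =1 g &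
      forall h' : C -> D, is_pmq_map h' -> h' \o i =1 g -> h' =1 h] }.

(* The enveloping group: words in the letters [a]^{+1} (coded (a, false)) and
   [a]^{-1} (coded (a, true)), modulo the least congruence containing free
   cancellation and the defining relations. *)
Definition env_word (Q : pmq) : Type := seq (Q * bool).
HB.instance Definition _ (Q : pmq) := gen_eqMixin (env_word Q).
HB.instance Definition _ (Q : pmq) := gen_choiceMixin (env_word Q).

Inductive env_cong (Q : pmq) : seq (Q * bool) -> seq (Q * bool) -> Prop :=
| env_refl u : env_cong u u
| env_sym u v : env_cong u v -> env_cong v u
| env_trans u v w : env_cong u v -> env_cong v w -> env_cong u w
| env_cat u u' v v' :
    env_cong u u' -> env_cong v v' -> env_cong (u ++ v) (u' ++ v')
| env_cancel a s : env_cong [:: (a, s); (a, ~~ s)] [::]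
| env_conj a b :
    env_cong [:: (b, true); (a, false); (b, false)] [:: (pmq_conj a b, false)]
| env_mul a b ab : pmq_mul a b = Some ab ->
    env_cong [:: (a, false); (b, false)] [:: (ab, false)].

Section EnvelopingGroup.
Variable Q : pmq.

Definition env_rel : rel (env_word Q) := fun u v => `[< env_cong u v >].

Fact env_rel_refl : reflexive env_rel.
Proof. by move=> u; apply/asboolP; apply: env_refl. Qed.

Fact env_rel_sym : symmetric env_rel.
Proof. by move=> u v; apply/asboolP/asboolP; apply: env_sym. Qed.

Fact env_rel_trans : transitive env_rel.
Proof.
by move=> v u w /asboolP uv /asboolP vw; apply/asboolP; apply: env_trans uv vw.
Qed.

Canonical env_equiv : equiv_rel (env_word Q) :=
  EquivRel env_rel env_rel_refl env_rel_sym env_rel_trans.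

Definition enveloping : Type := {eq_quot env_equiv}%qT.
HB.instance Definition _ := Choice.on enveloping.

Definition env_class (u : seq (Q * bool)) : enveloping :=
  (\pi_({eq_quot env_equiv}) (u : env_word Q))%qT.

Lemma env_classP u v : env_class u = env_class v <-> env_cong u v.
Proof.
split=> [/eqP | uv]; first by rewrite eqmodE => /asboolP.
by apply/eqP; rewrite eqmodE; apply/asboolP.
Qed.

Definition env_inv_word (u : seq (Q * bool)) : seq (Q * bool) :=
  rev [seq (l.1, ~~ l.2) | l <- u].

Definition env_mulg (x y : enveloping) : enveloping :=
  env_class ((repr x : seq (Q * bool)) ++ (repr y : seq (Q * bool))).
Definition env_invg (x : enveloping) : enveloping :=
  env_class (env_inv_word (repr x)).

Lemma env_classK x : env_class (repr x) = x.
Proof. exact: reprK. Qed.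

Lemma env_repr_class u : env_cong (repr (env_class u)) u.
Proof. by apply/env_classP; rewrite env_classK. Qed.

Lemma env_class_cat u v : env_class (u ++ v) = env_mulg (env_class u) (env_class v).
Proof.
by apply/env_classP; apply: env_cat; apply: env_sym; apply: env_repr_class.
Qed.

Fact env_mulgA : associative env_mulg.
Proof.
move=> x y z; rewrite -[x]env_classK -[y]env_classK -[z]env_classK.
by rewrite -!env_class_cat catA.
Qed.

Fact env_mul1g : left_id (env_class [::]) env_mulg.
Proof. by move=> x; rewrite -[x]env_classK -env_class_cat. Qed.

Fact env_mulg1 : right_id (env_class [::]) env_mulg.
Proof. by move=> x; rewrite -[x]env_classK -env_class_cat cats0. Qed.

Lemma env_inv_wordK : involutive env_inv_word.
Proof.
move=> u; rewrite /env_inv_word map_rev revK -map_comp.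
by rewrite (eq_map (_ : _ =1 id)) ?map_id // => -[a s] /=; rewrite negbK.
Qed.

Lemma env_cong_mulV u : env_cong (u ++ env_inv_word u) [::].
Proof.
elim: u => [|[a s] u IHu]; first exact: env_refl.
rewrite /env_inv_word /= rev_cons -cats1 catA -cat_cons -cat1s.
apply: env_trans (env_cancel a s); rewrite -[X in env_cong _ X]cat1s.
rewrite -[X in env_cong _ (_ ++ X)]cat0s catA; apply: env_cat (env_refl _).
rewrite -{2}[[:: (a, s)]]cats0 -catA; apply: env_cat; first exact: env_refl.
exact: IHu.
Qed.

Fact env_mulgV : right_inverse (env_class [::]) env_invg env_mulg.
Proof.
move=> x; rewrite -{1}[x]env_classK -env_class_cat.
by apply/env_classP; apply: env_cong_mulV.
Qed.

Fact env_mulVg : left_inverse (env_class [::]) env_invg env_mulg.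
Proof.
move=> x; rewrite -{2}[x]env_classK -env_class_cat.
apply/env_classP; rewrite -{2}[repr x]env_inv_wordK; exact: env_cong_mulV.
Qed.

HB.instance Definition _ :=
  isGroup.Build enveloping env_mulgA env_mul1g env_mulg1 env_mulVg env_mulgV.

Definition env_gen (a : Q) : enveloping := env_class [:: (a, false)].

End EnvelopingGroup.

(* The norm N(s): least number of transpositions with product s. *)
Section PermNorm.
Variable T : finType.
Implicit Types s t u : {perm T}.

Definition tperm_prod (m : nat) s : bool :=
  [exists ts : m.-tuple (T * T),
     all dpair ts && (s == \prod_(xy <- ts) tperm xy.1 xy.2)].

Fact tperm_prod_ex s : exists m, tperm_prod m s.
Proof.
have [ts -> dts] := prod_tpermP s; exists (size ts).
by apply/existsP; exists (in_tuple ts); rewrite dts eqxx.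
Qed.

Definition perm_norm s : nat := ex_minn (tperm_prod_ex s).

Lemma perm_normP s : exists ts : seq (T * T),
  [/\ size ts = perm_norm s, all dpair ts
    & s = \prod_(xy <- ts) tperm xy.1 xy.2].
Proof.
rewrite /perm_norm; case: ex_minnP => m /existsP[ts /andP[dts /eqP s_ts]] _.
by exists ts; rewrite size_tuple.
Qed.

Lemma perm_norm_min (ts : seq (T * T)) : all dpair ts ->
  (perm_norm (\prod_(xy <- ts) tperm xy.1 xy.2)%g <= size ts)%N.
Proof.
move=> dts; rewrite /perm_norm; case: ex_minnP => m _; apply.
by apply/existsP; exists (in_tuple ts); rewrite dts eqxx.
Qed.

Lemma perm_norm1 : perm_norm 1 = 0%N.
Proof.
by apply/eqP; rewrite -leqn0; have := @perm_norm_min [::] isT; rewrite big_nil.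
Qed.

Lemma perm_normM s t : (perm_norm (s * t)%g <= perm_norm s + perm_norm t)%N.
Proof.
have [ss [<- dss ->]] := perm_normP s; have [tt [<- dtt ->]] := perm_normP t.
by rewrite -size_cat -big_cat; apply: perm_norm_min; rewrite all_cat dss dtt.
Qed.

Lemma perm_normJ s t : perm_norm (s ^ t) = perm_norm s.
Proof.
suff le u v : (perm_norm (u ^ v)%g <= perm_norm u)%N.
  by apply/eqP; rewrite eqn_leq le /= -{1}(conjgK t s) le.
have [us [<- dus ->]] := perm_normP u.
rewrite (big_morph (conjg^~ v) (fun x y => conjMg x y v) (conj1g v)).
under eq_bigr => xy _ do rewrite tpermJ.
rewrite -(size_map (fun xy => (v xy.1, v xy.2)) us).
rewrite -(big_map (fun xy => (v xy.1, v xy.2)) xpredT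
            (fun xy => tperm xy.1 xy.2)).
apply: perm_norm_min; rewrite all_map; apply: sub_all dus => -[x y] /=.
by rewrite /dpair /= (inj_eq perm_inj).
Qed.

Definition geo_mul s t : option {perm T} :=
  if perm_norm (s * t) == (perm_norm s + perm_norm t)%N then Some (s * t)
  else None.

Fact geo_quandle : is_quandle (1 : {perm T}) (fun s t => s ^ t).
Proof.
split=> [t|t|s|s|s t u]; [|exact: conj1g|exact: conjg1|by rewrite conjgE mulKg|].
- by exists (conjg^~ t^-1); [exact: conjgK | exact: conjgKV].
- by rewrite conjJg.
Qed.

Fact geo_pmonoid : is_pmonoid (1 : {perm T}) geo_mul.
Proof.
split=> [s|s|s t u].
- by rewrite /geo_mul mul1g perm_norm1 eqxx.
- by rewrite /geo_mul mulg1 perm_norm1 addn0 eqxx.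
pose geo3 := perm_norm (s * t * u) == (perm_norm s + perm_norm t + perm_norm u)%N.
have le1 : (perm_norm (s * t * u)%g <= perm_norm (s * t)%g + perm_norm u)%N.
  exact: perm_normM.
have le2 : (perm_norm (s * t * u)%g <= perm_norm s + perm_norm (t * u)%g)%N.
  by rewrite -mulgA perm_normM.
have st := perm_normM s t; have tu := perm_normM t u.
transitivity (if geo3 then Some (s * t * u) else None).
  rewrite /geo_mul /geo3; case: (perm_norm (s * t) =P _) => [<-|nst] //=.
  case: eqP => // eq3.
  by case: nst; apply/eqP; rewrite eqn_leq st -(leq_add2r (perm_norm u)) -eq3.
rewrite /geo_mul /geo3 -addnA; case: (perm_norm (t * u) =P _) => [<-|ntu] /=.
  by rewrite mulgA.
case: eqP => // eq3; case: ntu; apply/eqP.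
by rewrite eqn_leq tu -(leq_add2l (perm_norm s)) -eq3.
Qed.

Fact geo_mul_swap s t : geo_mul s t = geo_mul t (s ^ t).
Proof. by rewrite /geo_mul -conjgC perm_normJ addnC. Qed.

Fact geo_conj_mul s t u tu : geo_mul t u = Some tu -> s ^ tu = (s ^ t) ^ u.
Proof. by rewrite /geo_mul; case: ifP => // _ [<-]; rewrite conjgM. Qed.

Fact geo_mul_conj s t u :
  geo_mul (s ^ u) (t ^ u) = omap (fun x => x ^ u) (geo_mul s t).
Proof. by rewrite /geo_mul -conjMg !perm_normJ; case: ifP. Qed.

Definition perm_geo : pmq :=
  PMQ geo_quandle geo_pmonoid geo_mul_swap geo_conj_mul geo_mul_conj.

End PermNorm.

(* The multiplicative copy of the additive group Z; the product groups of the
   library then provide Z x S_d. *)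
Definition multZ : Type := int.
HB.instance Definition _ := Choice.on multZ.
HB.instance Definition _ := isGroup.Build multZ
  (@addrA int) (@add0r int) (@addr0 int) (@addNr int) (@addrN int).

Definition same_parity (d : nat) : pred (multZ * 'S_d) :=
  fun g => odd (absz (g.1 : int)) == odd (perm_norm g.2).

Definition index2_subgroup (G : groupType) (H : pred G) : Prop :=
  [/\ group_closed H, exists g, ~~ H g
    & forall g h, ~~ H g -> ~~ H h -> H (g^-1 * h)].

(* The restriction of s to B, as a permutation of the set B.  It is meaningful
   when s preserves B; otherwise [restr_perm B s], and so the restriction, is
   the identity. *)
Section Restriction.
Variables (T : finType) (B : {set T}) (s : {perm T}).

Fact restr_on_subproof (x : {x | x \in B}) : restr_perm B s (val x) \in B.
Proof. by rewrite (perm_closed _ (restr_perm_on B s)) (valP x). Qed.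

Definition restr_on_fun (x : {x | x \in B}) : {x | x \in B} :=
  exist _ (restr_perm B s (val x)) (restr_on_subproof x).

Fact restr_on_inj : injective restr_on_fun.
Proof. by move=> x y [] /perm_inj/val_inj. Qed.

Definition restr_on : {perm {x | x \in B}} := perm restr_on_inj.
End Restriction.

(* A permutation, a family of blocks, and a weight on blocks.  Weights are
   functions on all subsets, required below to vanish off the partition, so
   that equality of weighted permutations is equality of the data. *)
Record wperm (d : nat) := WPerm {
  wperm_perm : 'S_d;
  wperm_part : {set {set 'I_d}};
  wperm_wt : {ffun {set 'I_d} -> nat} }.

Section GeoSequences.
Variable d : nat.
Implicit Types x y : wperm d.

Definition weighted_partition x : bool :=
  partition (wperm_part x) [set: 'I_d] &&
  [forall B, (B \notin wperm_part x) ==> (wperm_wt x B == 0%N)].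

Definition preserves_pieces x : bool :=
  [forall B in wperm_part x, [set wperm_perm x i | i in B] == B].

Definition weight_bound x : bool :=
  [forall B in wperm_part x,
     ((#|porbits (restr_on B (wperm_perm x))|%:Z
        <= (wperm_wt x B)%:Z + 2 - #|B|%:Z)%R)].

Definition weight_parity x : bool :=
  [forall B in wperm_part x,
     odd (wperm_wt x B) == odd (perm_norm (restr_on B (wperm_perm x)))].

(* Not implied by the three conditions above, which allow any even weight on a
   one-point piece; but there is no transposition of a one-point set. *)
Definition weight_singleton x : bool :=
  [forall B in wperm_part x, (#|B| == 1%N) ==> (wperm_wt x B == 0%N)].

Definition geo_admissible x : bool :=
  [&& weighted_partition x, preserves_pieces x, weight_bound x,
      weight_parity x & weight_singleton x].

Definition geo_seq : Type := {x : wperm d | geo_admissible x}.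

(* The finest common coarsening of two partitions. *)
Definition part_join (P R : {set {set 'I_d}}) : {set {set 'I_d}} :=
  equivalence_partition
    (connect (fun i j => (j \in pblock P i) || (j \in pblock R i)))
    [set: 'I_d].

Definition wperm_mul x y : wperm d :=
  let J := part_join (wperm_part x) (wperm_part y) in
  WPerm (wperm_perm x * wperm_perm y) J
    [ffun B : {set 'I_d} => if B \in J then
       (\sum_(A in wperm_part x | A \subset B) wperm_wt x A +
        \sum_(A in wperm_part y | A \subset B) wperm_wt y A)%N
     else 0%N].

(* In MathComp (s ^ t) (t i) = t (s i): conjugating by t relabels along t. *)
Definition wperm_conj x y : wperm d :=
  let t := wperm_perm y in
  WPerm (wperm_perm x ^ t)
    [set [set t i | i in (A : {set 'I_d})] | A in wperm_part x]
    [ffun B : {set 'I_d} => wperm_wt x [set i | t i \in B]].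

(* A cycle of length k is a product of k - 1 transpositions of its support. *)
Definition wperm_of (s : 'S_d) : wperm d :=
  WPerm s (porbits s)
    [ffun B : {set 'I_d} => if B \in porbits s then #|B|.-1 else 0%N].

End GeoSequences.

(* Main.v *)
(* The square z of a transposition (x y) commutes with everything, and next to
   a transposition (x a) it may be replaced by the square of (a y). A product
   of transpositions is therefore a product of a geodesic word of a permutation
   s by squares: multiplying s by a transposition either prolongs a geodesic or
   cancels one of its letters up to a square. In the enveloping group all the
   squares agree, which yields the normal form s z^k. In the completion, two
   families of squares give the same element as soon as they connect the orbits
   of s in the same way, with the same number of squares in each component, by
   the exchange argument that relates two spanning trees. The weight of a piece
   is the number of transpositions in it, and the lower bound on it says that a
   connected graph on n vertices has at least n - 1 edges. *)
Require Import Defs.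
From mathcomp Require Import all_boot all_order all_algebra all_fingroup.
From mathcomp Require Import boolp zify.
Set Implicit Arguments.
Unset Strict Implicit.
Unset Printing Implicit Defensive.
Local Open Scope group_scope.

(** * Words of transpositions, cycle counts and geodesics *)

Section Words.
Variable T : finType.
Implicit Types (s t : {perm T}) (A B : {set T}) (x y : T) (u v w : seq (T * T)).

(** Connectivity is treated through cuts rather than paths: only sets containing both or neither end
    of every letter occur. For a geodesic these are exactly the sets preserved by its product, and
    the number of letters in such a set is the norm of the restricted product. This is why replacing
    one geodesic by another changes neither pieces nor weights. The product, the cuts and the counts
    on cuts are invariants of a word, and the core of the completion half is that they are complete.
    As every admissible sequence comes from a word, the PMQ axioms, the closure under the operations
    and the universal property are all checked on words, where the product is concatenation and
    conjugation is relabelling. One-point pieces get weight 0 because a letter joining a point to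
    itself stands for the unit and is not counted. *)

Definition wprod w : {perm T} := \prod_(e <- w) tperm e.1 e.2.

Definition geodesic w := size w == perm_norm (wprod w).

Definition stable s A := forall x, (s x \in A) = (x \in A).

Definition clos w A := all (fun e : T * T => (e.1 \in A) == (e.2 \in A)) w.

(** Testing only the first end is enough on sets closed for [w]. Letters [(x, x)] are skipped since
    they stand for the unit. *)
Definition cnt w A := count (fun e : T * T => (e.1 != e.2) && (e.1 \in A)) w.

Lemma wprod_nil : wprod [::] = 1.
Proof. by rewrite /wprod big_nil. Qed.

Lemma wprod_cons e w : wprod (e :: w) = tperm e.1 e.2 * wprod w.
Proof. by rewrite /wprod big_cons. Qed.

Lemma wprod_cat u v : wprod (u ++ v) = wprod u * wprod v.
Proof. by rewrite /wprod big_cat. Qed.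

Lemma wprod1 e : wprod [:: e] = tperm e.1 e.2.
Proof. by rewrite wprod_cons wprod_nil mulg1. Qed.

Lemma perm_norm_wprod w : (perm_norm (wprod w) <= count (@dpair T) w)%N.
Proof.
rewrite -size_filter; have -> : wprod w = wprod (filter (@dpair T) w).
  elim: w => //= e w IHw; rewrite wprod_cons IHw /dpair.
  by case: eqP => [->|_]; rewrite ?tperm1 ?mul1g // wprod_cons.
by apply: perm_norm_min; apply: filter_all.
Qed.

Lemma leq_perm_norm w : (perm_norm (wprod w) <= size w)%N.
Proof. exact: leq_trans (perm_norm_wprod w) (count_size _ _). Qed.

Lemma geodesic_dpair w : geodesic w -> all (@dpair T) w.
Proof.
by rewrite /geodesic all_count => /eqP ws; rewrite eqn_leq count_size {1}ws perm_norm_wprod.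
Qed.

Lemma geodesic_catr u v : geodesic (u ++ v) -> geodesic v.
Proof.
rewrite /geodesic wprod_cat size_cat => /eqP uv; rewrite eqn_leq leq_perm_norm andbT.
have := perm_normM (wprod u) (wprod v); have := leq_perm_norm u; lia.
Qed.

Lemma geodesicP s : exists2 u, geodesic u & wprod u = s.
Proof.
by have [u [us _ su]] := perm_normP s; exists u; rewrite /geodesic /wprod -su ?us.
Qed.

Definition ncycles s : nat := #|porbits s|.

Lemma ncycles_mul_tperm s x y :
  (ncycles (tperm x y * s) + (x \notin porbit s y).*2 = ncycles s + (x != y))%N.
Proof. exact: porbits_mul_tperm. Qed.

Lemma leq_ncycles s : (ncycles s <= #|T|)%N.
Proof. exact: leq_imset_card. Qed.

(** A nontrivial permutation gains a cycle when a moved point is split off, which bounds the norm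
    from above. Conversely each letter of a word changes the number of cycles by at most one,
    starting from the [#|T|] cycles of the identity. *)
Lemma perm_norm_ncycles s : (perm_norm s + ncycles s = #|T|)%N.
Proof.
apply/eqP; rewrite eqn_leq; apply/andP; split.
  have := leq_ncycles; move: #|T| => c le_c.
  have [n] := ubnP (c - ncycles s); elim: n s => // n IHn s /ltnSE le_n.
  have [->|/eqP/permP s1] := eqVneq s 1; first by rewrite perm_norm1 le_c.
  have [x sx] : exists x, s x != x.
    apply/existsP; apply: contraT; rewrite negb_exists => /forallP sx.
    by case: s1 => x; rewrite perm1; apply/eqP; have := sx x; rewrite negbK.
  have := ncycles_mul_tperm s x (s x); rewrite eq_sym sx porbit_sym.
  rewrite (mem_porbit s 1) addn0 /= => eq_s; have := le_c (tperm x (s x) * s).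
  have := IHn (tperm x (s x) * s).
  have := perm_normM (tperm x (s x)) (tperm x (s x) * s); rewrite mulgA tperm2 mul1g.
  have := leq_perm_norm [:: (x, s x)]; rewrite wprod1 /=; lia.
have [u /eqP us <-] := geodesicP s; rewrite -us => {s us}.
elim: u => [|e u IHu].
  rewrite wprod_nil add0n /ncycles card_in_imset // => x y _ _ /= xy.
  have /porbitP[i] : x \in porbit 1 y by rewrite -xy porbit_id.
  by rewrite expg1n perm1.
have := ncycles_mul_tperm (wprod u) e.1 e.2; rewrite wprod_cons /=.
move: #|T| (size u) IHu => c k.
case: eqP => [->|_]; first by rewrite porbit_id /=; lia.
by case: (_ \notin _) => /=; lia.
Qed.

Lemma perm_norm_tpermM s x y : x != y ->
  perm_norm (tperm x y * s) =
    (if x \in porbit s y then (perm_norm s).-1 else (perm_norm s).+1).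
Proof.
move=> xy; have := ncycles_mul_tperm s x y; rewrite xy /=.
have := perm_norm_ncycles s; have := perm_norm_ncycles (tperm x y * s).
by move: #|T| => c; case: ifP => _ /=; lia.
Qed.

Lemma perm_norm_tperm x y : x != y -> perm_norm (tperm x y) = 1%N.
Proof.
move=> xy; have := perm_norm_tpermM 1 xy; rewrite mulg1 perm_norm1 => ->.
by rewrite porbit.unlock cycle1 imset_set1 apermE perm1 inE (negPf xy).
Qed.

Lemma odd_perm_norm s : odd (perm_norm s) = odd_perm s.
Proof. by rewrite /odd_perm -(perm_norm_ncycles s) /ncycles oddD addbK. Qed.

Lemma stableM s t A : stable s A -> stable t A -> stable (s * t) A.
Proof. by move=> sA tA x; rewrite permM tA sA. Qed.

Lemma stableX s A i : stable s A -> stable (s ^+ i) A.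
Proof.
by move=> sA; elim: i => [|i IHi] x; rewrite ?perm1 // expgS permM IHi sA.
Qed.

Lemma stable_tperm x y A : (x \in A) = (y \in A) -> stable (tperm x y) A.
Proof. by move=> xyA z; case: tpermP => // ->. Qed.

Lemma stable_porbit s x : stable s (porbit s x).
Proof.
move=> y; rewrite -!eq_porbit_mem; congr (_ == _).
by apply/eqP; rewrite eq_porbit_mem -{1}[s]expg1 mem_porbit.
Qed.

Lemma mem_stable_porbit s A x y : stable s A -> y \in porbit s x -> (y \in A) = (x \in A).
Proof. by move=> sA /porbitP[i ->]; rewrite stableX. Qed.

Lemma stable_norm s A : stable s A -> s \in 'N(A | 'P).
Proof.
by move=> sA; rewrite inE in_setT /= inE; apply/subsetP => x xA; rewrite inE /= apermE sA.
Qed.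

Lemma stableC s A : stable s A -> stable s (~: A).
Proof. by move=> sA x; rewrite !inE sA. Qed.

Lemma clos_cat u v A : clos (u ++ v) A = clos u A && clos v A.
Proof. exact: all_cat. Qed.

Lemma clos_cons e u A : clos (e :: u) A = ((e.1 \in A) == (e.2 \in A)) && clos u A.
Proof. by []. Qed.

Lemma closC u A : clos u (~: A) = clos u A.
Proof. by apply: eq_all => e; rewrite !inE; do 2!case: (_ \in A). Qed.

Lemma closI u A B : clos u A -> clos u B -> clos u (A :&: B).
Proof.
by elim: u => //= e u IHu /andP[/eqP eA uA] /andP[/eqP eB uB]; rewrite !inE eA eB eqxx IHu.
Qed.

Lemma closU u A B : clos u A -> clos u B -> clos u (A :|: B).
Proof. by move=> uA uB; rewrite -closC setCU closI ?closC. Qed.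

Lemma cnt_cat u v A : cnt (u ++ v) A = (cnt u A + cnt v A)%N.
Proof. exact: count_cat. Qed.

Lemma cntC u A : all (@dpair T) u -> (cnt u A + cnt u (~: A) = size u)%N.
Proof.
move=> du; rewrite /cnt -(count_predC (fun e : T * T => e.1 \in A) u).
congr (_ + _)%N; apply: eq_in_count => e /(allP du) /=.
  by move=> ->.
by rewrite inE => ->.
Qed.

Lemma clos_stable u A : clos u A -> stable (wprod u) A.
Proof.
elim: u => [|e u IHu] /=; first by move=> _ x; rewrite wprod_nil perm1.
move=> /andP[/eqP eA uA]; rewrite wprod_cons; apply: stableM (IHu uA).
exact: stable_tperm.
Qed.

Lemma geodesic_cons e u : geodesic u -> e.1 != e.2 ->
  geodesic (e :: u) = (e.1 \notin porbit (wprod u) e.2).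
Proof.
move=> /eqP gu de; rewrite /geodesic /= wprod_cons perm_norm_tpermM // gu.
by case: ifP => _; rewrite /= ?eqxx //; case: (perm_norm _) => [|n] //; lia.
Qed.

(** Multiplying twice by the transposition restores the cycle count, so one of the two steps splits
    a cycle and the other merges two. *)
Lemma porbit_tpermM s x y : x != y ->
  (x \in porbit (tperm x y * s) y) = (x \notin porbit s y).
Proof.
move=> xy; have := ncycles_mul_tperm (tperm x y * s) x y.
have := ncycles_mul_tperm s x y; rewrite mulgA tperm2 mul1g xy.
by case: (x \in _); case: (x \in _) => //=; lia.
Qed.

(** The first letter of a geodesic joins two cycles of the remaining product, so its ends lie in one
    cycle of the whole product and [A] does not separate them. The transposition then preserves [A],
    and so does the remaining product. *)
Lemma geodesic_stable u A : geodesic u -> stable (wprod u) A -> clos u A.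
Proof.
elim: u => //= e u IHu geu; rewrite wprod_cons => sA.
have gu : geodesic u by rewrite (@geodesic_catr [:: e]).
have de : e.1 != e.2 by have /andP[] := geodesic_dpair geu.
move: geu; rewrite geodesic_cons // => ne.
have eA : (e.1 \in A) = (e.2 \in A).
  apply: (mem_stable_porbit sA).
  by rewrite porbit_tpermM.
rewrite eA eqxx IHu // => x.
have := stableM (stable_tperm eA) sA; rewrite mulgA tperm2 mul1g; exact.
Qed.

Lemma geodesic_closE u A : geodesic u -> clos u A <-> stable (wprod u) A.
Proof. by move=> gu; split; [exact: clos_stable | exact: geodesic_stable]. Qed.

End Words.

(** * Restriction to preserved subsets and additivity of the norm *)

Section Restriction.
Variable T : finType.
Implicit Types (s : {perm T}) (A : {set T}) (u : seq (T * T)).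

Lemma restr_onE s A (x : {x | x \in A}) : stable s A -> sval (restr_on A s x) = s (sval x).
Proof.
move=> sA; rewrite permE /= restr_permE //; first exact: stable_norm.
exact: valP.
Qed.

(** The letters inside [A], read as transpositions of the subtype, form a word for the
    restriction. *)
Lemma leq_norm_restr u A : clos u A -> (perm_norm (restr_on A (wprod u)) <= cnt u A)%N.
Proof.
move=> uA; suff [v le_v vE] : exists2 v : seq ({x | x \in A} * {x | x \in A}),
    (size v <= cnt u A)%N & forall x, sval (wprod v x) = wprod u (sval x).
  apply: leq_trans le_v; rewrite (_ : restr_on A (wprod u) = wprod v) ?leq_perm_norm //.
  by apply/permP => x; apply/val_inj; rewrite /= vE restr_onE //; apply: clos_stable.
elim: u uA => [|[a b] u IHu] /=; first by exists [::] => // x; rewrite !wprod_nil !perm1.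
case/andP => /eqP abA /IHu[v le_v vE].
have [aA|aA] := boolP (a \in A); last first.
  exists v => [|x]; first by rewrite /cnt /= andbF.
  rewrite vE wprod_cons permM tpermD //=; apply: contraNneq aA.
    by move=> ->; apply: valP.
  by rewrite abA => ->; apply: valP.
have bA : b \in A by rewrite -abA.
have [eq_ab|ab] := eqVneq a b.
  exists v => [|x]; first by rewrite (leq_trans le_v) // leq_addl.
  by rewrite vE wprod_cons eq_ab tperm1 mul1g.
exists ((exist _ a aA, exist _ b bA) :: v) => [|x].
  by rewrite /= ?ab.
by rewrite !wprod_cons !permM vE; congr (_ _); case: tpermP => [->|->|/eqP x1 /eqP x2] /=;
  rewrite ?tpermL ?tpermR ?tpermD // eq_sym.
Qed.

Lemma leq_norm_split s A : stable s A ->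
  (perm_norm s <= perm_norm (restr_on A s) + perm_norm (restr_on (~: A) s))%N.
Proof.
have lift (B : {set T}) (v : seq ({x | x \in B} * {x | x \in B})) :
  exists u, [/\ size u = size v, forall x, wprod u (sval x) = sval (wprod v x)
    & forall x, x \notin B -> wprod u x = x].
  elim: v => [|e v [u [su uB unB]]].
    by exists [::]; split=> // x; rewrite ?wprod_nil !perm1.
  exists ((sval e.1, sval e.2) :: u); split=> [|x|x xB] /=; first by rewrite su.
    rewrite !wprod_cons !permM -uB /=; congr (_ _).
    by case: (tpermP _ _ x) => [->|->|/eqP x1 /eqP x2] /=;
      rewrite ?tpermL ?tpermR ?tpermD // eq_sym.
  rewrite wprod_cons permM /= tpermD ?unB //; apply: contraNneq xB => <-; exact: valP.
move=> sA; have [v /eqP gv vE] := geodesicP (restr_on A s).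
have [v' /eqP gv' vE'] := geodesicP (restr_on (~: A) s).
rewrite -[in leqRHS]vE -[in leqRHS]vE' -gv -gv'.
have [u [<- uA unA]] := lift _ v; have [u' [<- uA' unA']] := lift _ v'.
rewrite -size_cat; suff {1} -> : s = wprod (u ++ u') by apply: leq_perm_norm.
apply/permP => x; rewrite wprod_cat permM.
have [xA|xA] := boolP (x \in A).
  have /= -> := uA (exist _ x xA); rewrite vE restr_onE //= unA' // inE negbK.
  by rewrite sA.
rewrite unA //; have xA' : x \in ~: A by rewrite inE.
have /= -> := uA' (exist _ x xA'); rewrite vE' restr_onE //.
exact: stableC.
Qed.

(** The norms of the restrictions to [A] and to its complement are at most the two counts. The
    counts add up to the length of [u], which is the norm of the product and thus at most the sum of
    the two norms, so all these inequalities are equalities. *)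
Lemma geodesic_cnt u A : geodesic u -> clos u A ->
  cnt u A = perm_norm (restr_on A (wprod u)).
Proof.
move=> gu uA; have := leq_norm_split (clos_stable uA).
have := leq_norm_restr uA; have := uA; rewrite -closC => /leq_norm_restr.
by move/eqP: (gu) => <-; rewrite -(cntC A (geodesic_dpair gu)); lia.
Qed.

Lemma card_porbits_restr s A : stable s A ->
  #|porbits (restr_on A s)| = #|[set porbit s x | x in A]|.
Proof.
move=> sA; rewrite -(card_imset (mem (porbits (restr_on A s))) (imset_inj val_inj)).
have restrX i (x : {x | x \in A}) : sval ((restr_on A s ^+ i) x) = (s ^+ i) (sval x).
  elim: i x => [|i IHi] x; first by rewrite !perm1.
  by rewrite !expgS !permM IHi restr_onE.
have orbE (x : {x | x \in A}) : val @: porbit (restr_on A s) x = porbit s (sval x).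
  apply/setP => y; apply/imsetP/porbitP => [[_ /porbitP[i ->] ->]|[i ->]].
    by exists i; rewrite -restrX.
  by exists ((restr_on A s ^+ i) x); rewrite ?mem_porbit //= restrX.
apply: eq_card => B; apply/imsetP/imsetP => [[_ /imsetP[x _ ->] ->]|[x xA ->]].
  by exists (val x); rewrite ?orbE // (valP x).
exists (porbit (restr_on A s) (exist _ x xA)); last by rewrite orbE.
exact: imset_f.
Qed.

End Restriction.

(** * Connected components through closed sets *)

Section Connectivity.
Variable T : finType.
Implicit Types (A B : {set T}) (x y a b : T) (u v w : seq (T * T)).

Definition conn w x y := [forall A : {set T}, clos w A ==> (x \in A) ==> (y \in A)].

Definition component w x := [set y | conn w x y].

Lemma connP w x y :
  reflect (forall A, clos w A -> x \in A -> y \in A) (conn w x y).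
Proof.
apply: (iffP forallP) => xy A; last by apply/implyP => wA; apply/implyP; apply: xy.
by have /implyP wxy := xy A => /wxy/implyP.
Qed.

Arguments connP {w x y}.

Lemma conn_refl w x : conn w x x.
Proof. exact/connP. Qed.

Lemma clos_conn w A x y : clos w A -> conn w x y -> (x \in A) = (y \in A).
Proof.
move=> wA /connP xy; apply/idP/idP; first exact: xy.
by apply: contraLR; rewrite -!in_setC; apply: xy; rewrite closC.
Qed.

Lemma conn_sym w x y : conn w x y = conn w y x.
Proof. by apply/connP/connP => xy A wA; rewrite -(clos_conn wA (introT connP xy)). Qed.

Lemma conn_trans w y x z : conn w x y -> conn w y z -> conn w x z.
Proof. by move=> /connP xy /connP yz; apply/connP => A wA /(xy A wA)/(yz A wA). Qed.

Lemma conn_sub u v x y : (forall A, clos v A -> clos u A) -> conn u x y -> conn v x y.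
Proof. by move=> vu /connP xy; apply/connP => A /vu; apply: xy. Qed.

Lemma eq_conn u v : clos u =1 clos v -> conn u =2 conn v.
Proof. by move=> uv x y; apply/idP/idP; apply: conn_sub => A; rewrite uv. Qed.

Lemma conn_mem w e : e \in w -> conn w e.1 e.2.
Proof. by move=> ew; apply/connP => A /allP/(_ e ew)/eqP ->. Qed.

Lemma component_clos w x : clos w (component w x).
Proof.
apply/allP => e /conn_mem ew; rewrite !inE; apply/eqP; apply/idP/idP => xe.
  exact: conn_trans ew.
by apply: conn_trans xe _; rewrite conn_sym.
Qed.

Lemma component_sub w A x : clos w A -> x \in A -> component w x \subset A.
Proof. by move=> wA xA; apply/subsetP => y; rewrite inE => /connP; apply. Qed.

Lemma closP w A : reflect (forall x y, conn w x y -> (x \in A) = (y \in A)) (clos w A).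
Proof.
apply: (iffP idP) => [wA x y|wA]; first exact: clos_conn.
by apply/allP => e /conn_mem/wA ->.
Qed.

(** The component of [x] for [u] contains exactly one end of [e], since otherwise it stays closed
    after adding [e] and separates [x] from [y]. Its union with the component of the other end is
    closed for [e :: u], hence contains [y]. *)
Lemma conn_cons e u x y : conn (e :: u) x y -> ~~ conn u x y ->
  (conn u x e.1 /\ conn u e.2 y) \/ (conn u x e.2 /\ conn u e.1 y).
Proof.
have half a b : conn u x a -> ~~ conn u x b -> (forall A, clos u A ->
    (a \in A) = (b \in A) -> clos (e :: u) A) ->
    conn (e :: u) x y -> ~~ conn u x y -> conn u b y.
  move=> xa xb cl /connP/(_ (component u x :|: component u b)); rewrite !inE conn_refl.
  rewrite (cl (component u x :|: component u b)) ?closU ?component_clos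
    ?inE ?xa ?conn_refl ?orbT //.
  by move=> /(_ isT isT)/orP[] // ->.
move=> xy nxy; have [x1|nx1] := boolP (conn u x e.1); have [x2|nx2] := boolP (conn u x e.2).
- case/negP: nxy; move/connP/(_ (component u x)): xy.
  rewrite clos_cons !inE x1 x2 component_clos /= conn_refl.
  by apply.
- left; split=> //; apply: (half e.1) => // A uA eA; first by rewrite clos_cons eA eqxx.
- right; split=> //; apply: (half e.2) => // A uA eA; first by rewrite clos_cons eA eqxx.
case/negP: nxy; move/connP/(_ (component u x)): xy.
by rewrite clos_cons !inE (negPf nx1) (negPf nx2) component_clos /= conn_refl; apply.
Qed.

Lemma cnt_disjoint u A B : [disjoint A & B] ->
  cnt u (A :|: B) = (cnt u A + cnt u B)%N.
Proof.
move=> dAB; rewrite /cnt -count_predUI.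
rewrite [X in (_ + X)%N](_ : _ = 0%N) ?addn0.
  by apply: eq_count => e /=; rewrite inE andb_orr.
rewrite -(@count_pred0 (T * T)%type u); apply: eq_count => e /=.
by case: (_ != _) => //=; apply/negbTE/andP => -[eA]; rewrite (disjointFr dAB eA).
Qed.

(** An added edge either leaves the component unchanged or glues two disjoint ones; in the second
    case the bounds add up and the surplus 1 is paid for by the new edge. *)
Lemma card_component u x : (#|component u x| <= (cnt u (component u x)).+1)%N.
Proof.
elim: u x => [|e u IHu] x.
  apply: leq_trans (subset_leq_card (component_sub (A := [set x]) _ _)) _ => //.
    by rewrite inE.
  by rewrite cards1.
have sub_cons z : component u z \subset component (e :: u) z.
  by apply/subsetP => y; rewrite !inE; apply: conn_sub => A /andP[].
(* The ends are not read off from [e], so that the claim applies to either orientation of the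
   edge. *)
have split_cons a b : a != b -> conn u x a -> ~~ conn u x b ->
  (forall A, clos (e :: u) A = ((a \in A) == (b \in A)) && clos u A) ->
  (forall A, b \in A -> a \in A -> cnt (e :: u) A = (cnt u A).+1) ->
  (#|component (e :: u) x| <= (cnt (e :: u) (component (e :: u) x)).+1)%N.
- move=> ab xa nxb cl ct.
  have sub : component (e :: u) x \subset component u x :|: component u b.
    apply: component_sub; last by rewrite !inE conn_refl.
    by rewrite cl closU ?component_clos // !inE xa conn_refl orbT.
  have xa' : conn (e :: u) x a by have := subsetP (sub_cons x) a; rewrite !inE; apply.
  have xb' : conn (e :: u) x b.
    by have := component_clos (e :: u) x; rewrite cl !inE xa' => /andP[/eqP <-].
  rewrite ct ?inE //.
  have dis : [disjoint component u x & component u b].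
    rewrite disjoint_subset; apply/subsetP => y; rewrite !inE => xy.
    apply: contra nxb => byy; apply: conn_trans xy _; by rewrite conn_sym.
  have -> : component (e :: u) x = component u x :|: component u b.
    apply/eqP; rewrite eqEsubset sub subUset sub_cons /=.
    apply: subset_trans (sub_cons b) _; apply/subsetP => y; rewrite !inE.
    exact: conn_trans.
  rewrite cnt_disjoint // cardsU; have := IHu x; have := IHu b; lia.
case: e sub_cons split_cons => a b sub_cons split_cons.
have [eq_ab|ab] := boolP ((a \in component u x) == (b \in component u x)).
  have -> : component ((a, b) :: u) x = component u x.
    apply/eqP; rewrite eqEsubset sub_cons andbT component_sub ?inE ?conn_refl //.
    by rewrite clos_cons eq_ab component_clos.
  apply: leq_trans (IHu x) _; rewrite ltnS; exact: leq_addl.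
have neq_ab : a != b by apply: contraNneq ab => ->.
move: ab; rewrite !inE; have [xa|nxa] := boolP (conn u x a) => /= nxb.
  apply: (split_cons a b) => // A _ aA; first by rewrite /cnt /= neq_ab aA.
apply: (split_cons b a) => //; first by rewrite eq_sym.
- by move: nxb; case: (conn u x b).
- by move=> A; rewrite clos_cons eq_sym.
by move=> A aA _; rewrite /cnt /= neq_ab aA.
Qed.

End Connectivity.

(** * Completeness of the invariants for the Hurwitz relations *)

Section Hurwitz.
Variable T : finType.
Implicit Types (s t p : {perm T}) (A B : {set T}) (x y : T) (e : T * T).
Implicit Types (u v w E : seq (T * T)).

Definition edge_act e p := (p e.1, p e.2).

Definition dbl E := flatten [seq [:: e; e] | e <- E].

(* The letter (x, y) stands for the transposition of x and y, and (x, x) for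
   the unit. *)
Inductive hcong : seq (T * T) -> seq (T * T) -> Prop :=
| hcong_refl u : hcong u u
| hcong_sym u v : hcong u v -> hcong v u
| hcong_trans v u w : hcong u v -> hcong v w -> hcong u w
| hcong_cat u u' v v' : hcong u u' -> hcong v v' -> hcong (u ++ v) (u' ++ v')
| hcong_swap a b : hcong [:: a; b] [:: b; edge_act a (tperm b.1 b.2)]
| hcong_geo u v : geodesic u -> geodesic v -> wprod u = wprod v -> hcong u v
| hcong_loop x : hcong [:: (x, x)] [::].

(** The pieces enter only through their unions, the closed sets. Counts are compared on these alone,
    because the relabelling in a swap may change the count on other sets. *)
Definition same u v :=
  [/\ wprod u = wprod v, clos u =1 clos v & forall A, clos u A -> cnt u A = cnt v A].

Lemma same_sym u v : same u v -> same v u.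
Proof. by case=> p c n; split=> // A vA; rewrite -n ?c. Qed.

Lemma same_trans v u w : same u v -> same v w -> same u w.
Proof.
case=> p c n [p' c' n']; split=> [|A|A uA]; rewrite ?p ?c ?n ?n' //.
by rewrite -c.
Qed.

(** A swap relabels a letter by a transposition that preserves every closed set. For two geodesics
    with the same product, the closed sets are those preserved by it and the counts are norms of its
    restrictions. *)
Lemma hcong_same u v : hcong u v -> same u v.
Proof.
elim=> {u v} [u|u v _|v u w _ uv _|u u' v v' _ [p c n] _ [p' c' n']|[a a'] [b b']|u v gu gv uv|x].
- by [].
- exact: same_sym.
- exact: same_trans.
- split=> [|A|A]; rewrite ?wprod_cat ?p ?p' // !clos_cat ?c ?c' //.
  by rewrite -c -c' => /andP[uA vA]; rewrite !cnt_cat n ?n'.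
- split=> [|A|A].
  + by rewrite !wprod_cons !wprod_nil !mulg1 /= -tpermJ -conjgC.
  + rewrite /= !andbT andbC; case: eqP => //= bA.
    by rewrite !(stable_tperm bA).
  + case/and3P => _ /eqP bA _; rewrite /cnt /= !addn0 addnC (inj_eq perm_inj).
    by rewrite (stable_tperm bA).
- split=> // [A|A uA].
    by apply/idP/idP; rewrite !geodesic_closE ?uv.
  have vA : clos v A by rewrite geodesic_closE // -uv -geodesic_closE.
  by rewrite !geodesic_cnt ?uv.
split=> [|A|A _] /=; first by rewrite wprod1 tperm1 wprod_nil.
  by rewrite eqxx.
by rewrite /cnt /= eqxx.
Qed.

Lemma hcong_catl w u v : hcong u v -> hcong (w ++ u) (w ++ v).
Proof. exact: hcong_cat (hcong_refl w). Qed.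

Lemma hcong_catr w u v : hcong u v -> hcong (u ++ w) (v ++ w).
Proof. by move=> uv; apply: hcong_cat uv (hcong_refl w). Qed.

(** Moving a letter past [e] twice conjugates it twice by one transposition, which restores it. *)
Lemma hcong_sq_comm e w : hcong (w ++ [:: e; e]) ([:: e; e] ++ w).
Proof.
elim: w => [|a w IHw] /=; first exact: hcong_refl.
apply: hcong_trans (hcong_catl [:: a] IHw) _.
apply: (@hcong_catr w [:: a; e; e] [:: e; e; a]).
apply: hcong_trans (hcong_catr [:: e] (hcong_swap a e)) _ => /=.
apply: (@hcong_catl [:: e] [:: _; e] [:: e; a]).
apply: hcong_trans (hcong_swap _ e) _; rewrite /edge_act /= !tpermK -surjective_pairing.
exact: hcong_refl.
Qed.

(** The square passes to the left of [a] unchanged; each of its letters is then moved back across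
    [a] and is conjugated on the way. *)
Lemma hcong_sq_act a e :
  hcong [:: a; e; e] [:: a; edge_act e (tperm a.1 a.2); edge_act e (tperm a.1 a.2)].
Proof.
apply: hcong_trans (hcong_sq_comm e [:: a]) _ => /=.
apply: hcong_trans (hcong_catl [:: e] (hcong_swap e a)) _ => /=.
exact: (hcong_catr [:: edge_act e (tperm a.1 a.2)] (hcong_swap e a)).
Qed.

Lemma hcong_sq_tperm u a e : a \in u ->
  hcong (u ++ [:: e; e])
    (u ++ [:: edge_act e (tperm a.1 a.2); edge_act e (tperm a.1 a.2)]).
Proof.
case/splitPr => u1 u2; rewrite -!catA /= -!cat_cons; apply: hcong_catl.
apply: hcong_trans (hcong_catl [:: a] (hcong_sq_comm e u2)) _ => /=.
apply: hcong_trans (hcong_catr u2 (hcong_sq_act a e)) _ => /=.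
apply: (hcong_catl [:: a]); apply: hcong_sym; exact: hcong_sq_comm.
Qed.

Lemma edge_actM e s t : edge_act (edge_act e s) t = edge_act e (s * t).
Proof. by rewrite /edge_act /= !permM. Qed.

Lemma edge_act1 e : edge_act e 1 = e.
Proof. by case: e => x y; rewrite /edge_act !perm1. Qed.

(* The permutations preserving the class of u q, for all squares q, form a
   group, which contains all transpositions inside a component of u. *)
Lemma hcong_sq_conn u x y e : conn u x y ->
  hcong (u ++ [:: e; e])
    (u ++ [:: edge_act e (tperm x y); edge_act e (tperm x y)]).
Proof.
pose H p := `[< forall e, hcong (u ++ [:: e; e]) (u ++ [:: edge_act e p; edge_act e p]) >].
have HM p q : H p -> H q -> H (p * q).
  move=> /asboolP Hp /asboolP Hq; apply/asboolP => f.
  by rewrite -edge_actM; apply: hcong_trans (Hp f) (Hq _).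
have H1 : H 1 by apply/asboolP => f; rewrite edge_act1; apply: hcong_refl.
have Hu f : f \in u -> H (tperm f.1 f.2).
  by move=> fu; apply/asboolP => f'; apply: hcong_sq_tperm.
pose A := [set y | H (tperm x y)].
suff uA : clos u A.
  move=> /connP/(_ A uA); rewrite !inE tperm1 => /(_ H1)/asboolP; exact.
have step b c : H (tperm b c) -> b \in A -> c \in A.
  rewrite !inE => Hbc Hxb; have [<-|xb] := eqVneq b x; first by rewrite tpermC -1?tpermC.
  have [<-|xc] := eqVneq c x; first by rewrite tperm1.
  have -> : tperm x c = tperm x b ^ tperm b c by rewrite tpermJ tpermL tpermD.
  by rewrite conjgE tpermV; apply: (HM) => //; apply: (HM).
apply/allP => f /Hu Hf; apply/eqP; apply/idP/idP; apply: step => //.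
by rewrite tpermC.
Qed.

(** The first factor sends [i] to [k]; the second corrects the image of [j] to [l] while fixing
    [k]. *)
Lemma tperm_pair_ex i j k l : i != j -> k != l ->
  edge_act (i, j) (tperm i k * tperm (tperm i k j) l) = (k, l) :> T * T.
Proof.
move=> ij kl; rewrite /edge_act /= !permM tpermL tpermL.
rewrite tpermD // 1?eq_sym //; apply: contraNneq ij => /(canLR (tpermK i k)).
by rewrite tpermR => <-.
Qed.

Lemma hcong_sq_eq u i j k l : conn u i k -> conn u i j -> conn u k l ->
  i != j -> k != l -> hcong (u ++ [:: (i, j); (i, j)]) (u ++ [:: (k, l); (k, l)]).
Proof.
move=> ik ij kl nij nkl.
rewrite -(tperm_pair_ex nij nkl) -edge_actM.
apply: hcong_trans (hcong_sq_conn _ ik) _; apply: hcong_sq_conn.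
have il := conn_trans ik kl.
by case: tpermP => // _ _; apply: conn_trans il; rewrite conn_sym.
Qed.

Lemma dbl_cons e E : dbl (e :: E) = [:: e; e] ++ dbl E.
Proof. by []. Qed.

Lemma mem_dbl E : dbl E =i E.
Proof. by move=> e; elim: E => //= f E IHE; rewrite !inE IHE orbA orbb. Qed.

Lemma dbl_cat E F : dbl (E ++ F) = dbl E ++ dbl F.
Proof. by rewrite /dbl map_cat flatten_cat. Qed.

Lemma clos_dbl E : clos (dbl E) =1 clos E.
Proof. by move=> A; elim: E => //= e E ->; rewrite andbA andbb. Qed.

Lemma cnt_dbl E A : cnt (dbl E) A = (cnt E A).*2.
Proof. by elim: E => //= e E; rewrite /cnt /= => ->; lia. Qed.

Lemma wprod_dbl E : wprod (dbl E) = 1.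
Proof. by elim: E => [|e E IHE]; rewrite ?wprod_nil //= !wprod_cons IHE mulg1 ?tperm2. Qed.

Lemma hcong_dbl_front E e : e \in E ->
  exists2 F, perm_eq E (e :: F) & hcong (dbl E) (dbl (e :: F)).
Proof.
case/splitPr => E1 E2; exists (E1 ++ E2); first by rewrite -cat1s perm_catCA.
rewrite !dbl_cat !dbl_cons !dbl_cat !catA; apply: hcong_catr; exact: hcong_sq_comm.
Qed.

Lemma hcong_normal w u : geodesic u -> wprod u = wprod w ->
  exists2 E, all (@dpair T) E & hcong w (u ++ dbl E).
Proof.
elim: w u => [|e w IHw] u gu uw.
  exists [::] => //=; rewrite cats0; apply: hcong_geo => //.
  by rewrite /geodesic wprod_nil perm_norm1.
have [v gv vw] := geodesicP (wprod w); have [E dE wE] := IHw v gv vw.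
have [e12|de] := eqVneq e.1 e.2.
  exists E => //; apply: (@hcong_trans w).
    by case: e e12 uw => x y /= -> _; apply: (hcong_catr w (hcong_loop y)).
  apply: hcong_trans wE _; apply: hcong_catr; apply: hcong_geo => //.
  by rewrite vw uw wprod_cons e12 tperm1 mul1g.
have /hcong_trans red : hcong (e :: w) ((e :: v) ++ dbl E) := hcong_catl [:: e] wE.
have [gev|] := boolP (geodesic (e :: v)).
  exists E => //; apply: red; apply: hcong_catr; apply: hcong_geo => //.
  by rewrite uw !wprod_cons vw.
rewrite geodesic_cons // negbK => e_orb.
(* Here [e] cancels: [e :: u] is a geodesic for the product of [v], so [e :: v] becomes
   [e :: e :: u] and a square appears in front of [u]. *)
have geu : geodesic (e :: u) by rewrite geodesic_cons // uw wprod_cons porbit_tpermM // -vw e_orb.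
exists (e :: E); first by rewrite /= de.
apply: red; apply: (@hcong_trans ((e :: e :: u) ++ dbl E)).
  apply: hcong_catr; apply: (hcong_catl [:: e]); apply: hcong_geo => //.
  by rewrite !wprod_cons uw wprod_cons mulgA tperm2 mul1g.
rewrite dbl_cons catA; apply: hcong_catr; apply: hcong_sym; exact: hcong_sq_comm.
Qed.

(** The first square that connects [i] and [j] is a bridge between their components for the word
    before it. Moving its ends inside these components turns it into the square of [(i, j)]; the
    other squares are kept. *)
Lemma hcong_exchange u E i j : all (@dpair T) E ->
  conn (u ++ dbl E) i j -> ~~ conn u i j ->
  exists2 F, all (@dpair T) F & hcong (u ++ dbl E) (u ++ dbl ((i, j) :: F)).
Proof.
elim: E u => [|f E IHE] u /=; first by rewrite cats0 => _ ->.
case/andP => df dE; rewrite dbl_cons catA => ij nij.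
have [ij1|nij1] := boolP (conn (u ++ [:: f; f]) i j); last first.
  have [F dF EF] := IHE _ dE ij nij1; exists (f :: F); first by rewrite /= df.
  apply: hcong_trans EF _; rewrite !dbl_cons -!catA; apply: hcong_catl.
  rewrite !catA; apply: hcong_catr; exact: (hcong_sq_comm (i, j) [:: f; f]).
exists E => //; rewrite dbl_cons catA; apply: hcong_catr.
have {}ij1 : conn (f :: u) i j.
  by rewrite -(@eq_conn _ (u ++ [:: f; f])) // => A; rewrite clos_cat /= andbT andbb andbC.
have nij' : i != j by apply: contraNneq nij => ->; apply: conn_refl.
have key a b : conn u i a -> conn u b j -> a != b ->
    hcong (u ++ [:: (a, b); (a, b)]) (u ++ [:: (i, j); (i, j)]).
  move=> ia bj ab; have nib : i != b by apply: contraNneq nij => ->.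
  have -> : (i, j) = edge_act (edge_act (a, b) (tperm a i)) (tperm b j).
    rewrite /edge_act /= tpermL (tpermD ab nib) tpermL tpermD // 1?eq_sym //.
  have ai : conn u a i by rewrite conn_sym.
  exact: hcong_trans (hcong_sq_conn _ ai) (hcong_sq_conn _ bj).
have [[i1 j2]|[i2 j1]] := conn_cons ij1 nij.
  by case: f df i1 j2 {ij ij1} => a b /= df i1 j2; apply: key.
(* The bridge is crossed backwards; a letter may be reversed, as both forms are geodesics of the
   same transposition. *)
case: f df i2 j1 {ij ij1} => a b /= df i2 j1; apply: hcong_trans (key b a _ _ _) => //.
  apply: hcong_catl.
  have eq1 : hcong [:: (a, b)] [:: (b, a)].
    apply: hcong_geo; rewrite /geodesic ?wprod1 /=; last exact: tpermC.
      by rewrite perm_norm_tperm.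
    by rewrite tpermC perm_norm_tperm.
  exact: (hcong_cat eq1 eq1).
by rewrite eq_sym.
Qed.

(** Induction on the number of squares in [E]: both sides are given a common first square, which is
    then absorbed into [u]. *)
Lemma hcong_dbl_uniq u E F : all (@dpair T) E -> all (@dpair T) F ->
  same (u ++ dbl E) (u ++ dbl F) -> hcong (u ++ dbl E) (u ++ dbl F).
Proof.
have [n] := ubnP (size E); elim: n u E F => // n IHn u [|e0 E0] F.
  move=> _ _ dF [_ _ /(_ setT)]; rewrite !cats0 cnt_cat cnt_dbl.
  have uT : clos u setT by apply/allP => e; rewrite !inE.
  case: F dF => [|f F] /=; first by rewrite cats0 => *; apply: hcong_refl.
  case/andP => df _ /(_ uT); rewrite /cnt /= df inE; lia.
set E := e0 :: E0 => le_n dE dF sEF.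
have step e E' F' : perm_eq E (e :: E') -> hcong (u ++ dbl E) (u ++ dbl (e :: E')) ->
    all (@dpair T) F' -> hcong (u ++ dbl F) (u ++ dbl (e :: F')) ->
    hcong (u ++ dbl E) (u ++ dbl F).
  move=> pE hE dF' hF; apply: (hcong_trans hE); apply: hcong_trans (hcong_sym hF).
  have := same_trans (same_sym (hcong_same hE)) (same_trans sEF (hcong_same hF)).
  rewrite !dbl_cons !catA; apply: IHn => //; last first.
    by have := perm_all (@dpair T) pE; rewrite dE => /esym/andP[].
  by rewrite -ltnS; apply: leq_ltn_trans le_n; rewrite (perm_size pE).
have clE A : clos (u ++ dbl E) A = clos u A && clos E A by rewrite clos_cat clos_dbl.
have clF A : clos (u ++ dbl F) A = clos u A && clos F A by rewrite clos_cat clos_dbl.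
have [p c ct] := sEF.
(* If an edge of [E] joins two components of [u], its ends are also connected through [F], and an
   exchange creates its square there. *)
have [/hasP[e eE ne]|/hasPn uE] := boolP (has (fun e => ~~ conn u e.1 e.2) E).
  have [E' pE hE] := hcong_dbl_front eE.
  have conn_e : conn (u ++ dbl F) e.1 e.2.
    by rewrite -(eq_conn c); apply: conn_mem; rewrite mem_cat mem_dbl eE orbT.
  have [F' dF' hF] := hcong_exchange dF conn_e ne.
  apply: (step e E' F') => //; first exact: hcong_catl.
  by rewrite -surjective_pairing in hF.
have clu A : clos u A -> clos E A.
  by move=> uA; apply/allP => e /uE/negPn/(clos_conn uA) ->.
(* Now no edge of [E], hence none of [F], leaves a component of [u]. The counts give [F] an edge in
   the component of [e0], where all squares are equivalent after [u]. *)
have uA := component_clos u e0.1; set A := component u e0.1 in uA.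
have de0 : e0.1 != e0.2 by case/andP: dE.
have : (0 < cnt F A)%N.
  have := ct A; rewrite clE uA clu // !(cnt_cat u) !cnt_dbl => /(_ isT).
  have : (0 < cnt E A)%N by rewrite /cnt /= de0 inE conn_refl.
  lia.
rewrite -has_count => /hasP[f fF /andP[df fA]].
have [F' pF hF] := hcong_dbl_front fF.
have dF' : all (@dpair T) F'.
  by have := perm_all (@dpair T) pF; rewrite dF => /esym/andP[].
apply: (step e0 E0 F') => //; first exact: hcong_refl.
apply: hcong_trans (hcong_catl u hF) _; rewrite !dbl_cons !catA; apply: hcong_catr.
have uf : conn u f.1 f.2.
  rewrite -(@eq_conn _ (u ++ dbl F)); first by apply: conn_mem; rewrite mem_cat mem_dbl fF orbT.
  by move=> B; rewrite -c clE; have := clu B; case: (clos u B) => // ->.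
rewrite [f]surjective_pairing [e0]surjective_pairing; apply: hcong_sq_eq => //.
  by rewrite conn_sym; move: fA; rewrite inE.
by apply/negPn/uE; rewrite inE eqxx.
Qed.

Lemma same_hcong u v : same u v -> hcong u v.
Proof.
move=> suv; have [w gw wu] := geodesicP (wprod u).
have [E dE hE] := hcong_normal gw wu.
have [F dF hF] : exists2 F, all (@dpair T) F & hcong v (w ++ dbl F).
  by apply: hcong_normal; rewrite ?wu //; case: suv.
apply: (hcong_trans hE); apply: hcong_trans (hcong_sym hF).
apply: hcong_dbl_uniq => //; apply: same_trans (hcong_same hF).
by apply: same_trans suv; apply: same_sym; apply: hcong_same.
Qed.

End Hurwitz.

(** * Pieces, weights and relabelling of words *)

Section Components.
Variable T : finType.
Implicit Types (s : {perm T}) (A B : {set T}) (x y : T) (u v w : seq (T * T)).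

Definition wparts w := equivalence_partition (conn w) [set: T].

Lemma conn_equiv w : {in [set: T] & &, equivalence_rel (conn w)}.
Proof.
move=> x y z _ _ _; split=> [|xy]; first exact: conn_refl.
by apply/idP/idP; apply: conn_trans; rewrite // conn_sym.
Qed.

Lemma wparts_partition w : partition (wparts w) [set: T].
Proof. apply: equivalence_partitionP; exact: conn_equiv. Qed.

Lemma mem_wparts w B : reflect (exists x, B = component w x) (B \in wparts w).
Proof.
apply: (iffP imsetP) => [[x _ ->]|[x ->]]; exists x => //;
  by apply/setP => y; rewrite !inE.
Qed.

Lemma pblock_wparts w x y : (y \in pblock (wparts w) x) = conn w x y.
Proof. by rewrite pblock_equivalence_partition ?inE //; apply: conn_equiv. Qed.

Lemma wparts_clos w B : B \in wparts w -> clos w B.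
Proof. by case/mem_wparts => x ->; apply: component_clos. Qed.

Lemma eq_wparts u v : clos u =1 clos v -> wparts u = wparts v.
Proof.
move=> uv; apply/setP => B; apply/mem_wparts/mem_wparts => -[x ->]; exists x;
  by apply/setP => y; rewrite !inE (eq_conn uv).
Qed.

Lemma wparts_eq u v : wparts u = wparts v -> clos u =1 clos v.
Proof.
move=> uv A; have cuv x y : conn u x y = conn v x y by rewrite -!pblock_wparts uv.
by apply/closP/closP => cA x y; [rewrite -cuv | rewrite cuv]; apply: cA.
Qed.

(** Sorting letters by their first end makes the count additive over points. Hence weights on the
    pieces determine the counts on all closed sets, and weights add up when pieces are joined. *)
Lemma cnt_sum w u A : clos w A -> clos u A ->
  (\sum_(B in wparts w | B \subset A) cnt u B)%N = cnt u A.
Proof.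
move=> wA uA.
have cntE (B : {set T}) : cnt u B =
    (\sum_(x in B) count (fun e : T * T => (e.1 != e.2) && (e.1 == x)) u)%N.
  rewrite /cnt; elim: u {uA} => [|e u IHu] /=; first by rewrite big1.
  rewrite IHu big_split /=; congr (_ + _)%N.
  have [eB|neB] := boolP (e.1 \in B).
    rewrite (bigD1 e.1) //= eqxx big1 ?addn0 // => x /andP[_ /negPf].
    by rewrite eq_sym => ->; rewrite andbF.
  by rewrite big1 ?andbF // => x xB; case: (e.1 =P x) neB => [->|_]; rewrite ?xB ?andbF.
have /and3P[_ tr _] := wparts_partition w.
pose P := [set B in wparts w | B \subset A].
have trP : trivIset P.
  by apply: trivIsetS tr; apply/subsetP => B; rewrite inE => /andP[].
have AP : cover P =i A.
  move=> x; apply/bigcupP/idP => [[B]|xA].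
    by rewrite inE => /andP[_ /subsetP BA] /BA.
  exists (component w x); last by rewrite inE conn_refl.
  by rewrite inE component_sub // andbT; apply/mem_wparts; exists x.
rewrite cntE -(eq_bigl _ _ AP) big_trivIset //; apply: eq_big => B; first by rewrite inE.
by rewrite cntE.
Qed.

(* With r the number of edges in B and n the norm of the restriction of the
   product to B, this reads n <= r, r = n mod 2 and 2 |B| <= r + n + 2. *)
Lemma cnt_wparts w B : B \in wparts w -> exists k,
  cnt w B = (perm_norm (restr_on B (wprod w)) + k.*2)%N /\
  (#|B| <= (perm_norm (restr_on B (wprod w)) + k).+1)%N.
Proof.
case/mem_wparts => x ->; have [u gu uw] := geodesicP (wprod w).
have [E _ /hcong_same[_ cw nw]] := hcong_normal gu uw.
have cl := component_clos w x.
have clu : clos u (component w x) by have := cl; rewrite cw clos_cat => /andP[].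
have eq_comp : component (u ++ E) x = component w x.
  by apply/setP => y; rewrite !inE; apply: eq_conn => A; rewrite cw !clos_cat clos_dbl.
(* One copy of each square already connects the piece, so the edge bound involves the number of
   squares once, whereas the count of [w] involves it twice. *)
exists (cnt E (component w x)); rewrite nw // cnt_cat cnt_dbl -uw -geodesic_cnt //.
by split=> //; have := card_component (u ++ E) x; rewrite eq_comp cnt_cat.
Qed.

Lemma cnt_singleton w B : B \in wparts w -> #|B| = 1%N -> cnt w B = 0%N.
Proof.
move=> /wparts_clos/allP clB /eqP/cards1P[z Bz].
apply/eqP; rewrite -leqn0 leqNgt -has_count; apply/hasPn => e /clB.
rewrite Bz !inE; case: (e.1 =P z) => [->|_]; rewrite ?andbF //.
by move=> /eqP/esym/eqP ->; rewrite eqxx.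
Qed.

Lemma stable_im s A : stable s A -> [set s x | x in A] = A.
Proof.
move=> sA; apply/eqP; rewrite eqEcard card_imset ?leqnn ?andbT; last exact: perm_inj.
by apply/subsetP => _ /imsetP[x xA ->]; rewrite sA.
Qed.

Lemma im_stable s A : [set s x | x in A] = A -> stable s A.
Proof. by move=> sA x; rewrite -{1}sA mem_imset //; apply: perm_inj. Qed.

Definition wact w s := [seq edge_act e s | e <- w].

Lemma wprod_act w s : wprod (wact w s) = wprod w ^ s.
Proof.
elim: w => [|e w IHw]; first by rewrite wprod_nil conj1g.
by rewrite /= !wprod_cons conjMg tpermJ IHw.
Qed.

Lemma clos_act w s A : clos (wact w s) A = clos w (s @^-1: A).
Proof. by rewrite /clos all_map; apply: eq_all => e /=; rewrite !inE. Qed.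

Lemma cnt_act w s A : cnt (wact w s) A = cnt w (s @^-1: A).
Proof.
by rewrite /cnt count_map; apply: eq_count => e /=; rewrite !inE (inj_eq perm_inj).
Qed.

Lemma component_act w s x : component (wact w s) (s x) = s @: component w x.
Proof.
apply/setP => y; apply/idP/imsetP => [|[z zx ->]]; rewrite inE.
  move=> xy; exists (s^-1 y); rewrite ?permKV // inE; apply/connP => A wA xA.
  have /connP/(_ (s @: A)) := xy; rewrite mem_imset; last exact: perm_inj.
  rewrite -{1}[y](permKV s) mem_imset; last exact: perm_inj.
  apply=> //; rewrite clos_act; congr (clos w _): wA.
  by apply/setP => z; rewrite inE mem_imset //; apply: perm_inj.
apply/connP => A; rewrite clos_act => wA; move: zx; rewrite inE.
by move/connP/(_ _ wA); rewrite !inE.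
Qed.

Lemma wparts_act w s : wparts (wact w s) = [set s @: A | A : {set T} in wparts w].
Proof.
apply/setP => B; apply/mem_wparts/imsetP => [[x ->]|[_ /mem_wparts[x ->] ->]].
  exists (component w (s^-1 x)); first by apply/mem_wparts; exists (s^-1 x).
  by rewrite -component_act permKV.
by exists (s x); rewrite component_act.
Qed.

Lemma wact_geodesic u s : geodesic u -> geodesic (wact u s).
Proof. by rewrite /geodesic size_map wprod_act perm_normJ. Qed.

(** The closed sets of [u] are preserved by its product, so relabelling along it does not affect
    them. This becomes the axiom that conjugating an element by itself changes nothing. *)
Lemma same_act u : same (wact u (wprod u)) u.
Proof.
have pre A : stable (wprod u) A -> wprod u @^-1: A = A.
  by move=> sA; apply/setP => x; rewrite inE sA.
have cl A : clos u (wprod u @^-1: A) -> stable (wprod u) A.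
  move=> /clos_stable sA x; have := sA ((wprod u)^-1 x); rewrite !inE permKV => -> //.
split=> [|A|A]; first by rewrite wprod_act conjgE mulKg.
  rewrite clos_act; apply/idP/idP => uA; first by rewrite -(pre A) //; apply: cl.
  by rewrite pre //; apply: clos_stable.
by rewrite clos_act cnt_act => uA; rewrite pre //; apply: cl.
Qed.

Lemma same_swap u v : same (u ++ v) (v ++ wact u (wprod v)).
Proof.
split=> [|A|A]; first by rewrite !wprod_cat wprod_act -conjgC.
  rewrite !clos_cat clos_act andbC; apply: andb_id2l => /clos_stable vA.
  by congr (clos u _); apply/setP => x; rewrite inE vA.
rewrite !clos_cat => /andP[_ /clos_stable vA]; rewrite !cnt_cat cnt_act addnC.
by congr (_ + cnt u _)%N; apply/setP => x; rewrite inE vA.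
Qed.

End Components.

(** * Realization of prescribed pieces and weights by words *)

Section Realization.
Variable T : finType.
Implicit Types (s : {perm T}) (A B : {set T}) (x y : T) (u v w : seq (T * T)).

Lemma perm_norm_restr_porbits s B :
  (perm_norm (restr_on B s) + #|porbits (restr_on B s)| = #|B|)%N.
Proof.
have := perm_norm_ncycles (restr_on B s); rewrite /ncycles card_sig => ->.
by apply: eq_card.
Qed.

(* A star centred at a point of B, with one edge to each other orbit in B. *)
Lemma star_edges u B k : geodesic u -> clos u B -> B != set0 ->
  (#|B| <= (perm_norm (restr_on B (wprod u)) + k).+1)%N -> (#|B| = 1 -> k = 0)%N ->
  exists E, [/\ all (@dpair T) E, size E = k,
    all (fun e => (e.1 \in B) && (e.2 \in B)) E
    & {in B &, forall x y, conn (u ++ E) x y}].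
Proof.
move=> gu uB /set0Pn[b bB] le_B B1; set s := wprod u in le_B *.
have sB : stable s B := clos_stable uB.
pose S := [set porbit s x | x in B] :\ porbit s b.
have SP A : A \in S -> exists2 x, x \in B & A = porbit s x /\ b \notin A.
  rewrite in_setD1 => /andP[nA /imsetP[x xB eA]]; exists x => //; split=> //.
  by rewrite eA in nA *; rewrite -eq_porbit_mem eq_sym.
have cS : (#|S|.+1 + perm_norm (restr_on B s) = #|B|)%N.
  rewrite -(perm_norm_restr_porbits s B) card_porbits_restr // addnC; congr (_ + _)%N.
  by rewrite [RHS](cardsD1 (porbit s b)) imset_f.
have le_S : (#|S| <= k)%N by move: le_B; rewrite -cS addnC -addnS leq_add2l ltnS.
pose r (A : {set T}) := odflt b [pick x in A].
have rP A : A \in S -> [/\ r A \in A, r A \in B & r A != b].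
  case/SP => x xB [eA nbA]; have rA : r A \in A.
    by rewrite /r; case: pickP => //= /(_ x); rewrite eA porbit_id.
  split=> //; first by move: rA; rewrite eA => /(mem_stable_porbit sB) ->.
  by apply: contraNneq nbA => <-.
pose E0 := [seq (b, r A) | A <- enum S].
(* Padding edges need a second point of [B]. If there is none, then [k] is 0, no padding occurs, and
   [b] itself serves. *)
have [b' b'B nb'] : exists2 b', b' \in B & (k - #|S| > 0)%N -> b' != b.
  have [|] := boolP (B :\ b == set0); last first.
    by case/set0Pn => b'; rewrite !inE => /andP[nb b'B]; exists b'.
  rewrite setD_eq0 => /subset_leq_card; rewrite cards1 => le1.
  exists b => //; rewrite B1 ?sub0n //; apply/eqP; rewrite eqn_leq le1 /=.
  by apply/card_gt0P; exists b.
exists (E0 ++ nseq (k - #|S|) (b, b')); split.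
- rewrite all_cat all_map all_nseq; apply/andP; split.
    by apply/allP => A; rewrite mem_enum => /rP[_ _]; rewrite /= eq_sym.
  by case: posnP nb' => //= _ /(_ isT); rewrite eq_sym.
- by rewrite size_cat size_map size_nseq -cardE subnKC.
- rewrite all_cat all_map all_nseq; apply/andP; split.
    by apply/allP => A; rewrite mem_enum => /rP[_ rB _] /=; rewrite bB.
  by rewrite /= bB b'B orbT.
suff bx x : x \in B -> conn (u ++ E0 ++ nseq (k - #|S|) (b, b')) b x.
  move=> x y /bx xb /bx; apply: conn_trans; by rewrite conn_sym.
move=> xB; apply/connP => A; rewrite !clos_cat => /and3P[/clos_stable sA EA _] bA.
have [b_x|nb_x] := eqVneq (porbit s x) (porbit s b).
  by rewrite (mem_stable_porbit sA (x := b)) // -b_x porbit_id.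
have xS : porbit s x \in S by rewrite !inE nb_x imset_f.
have [rx _ _] := rP _ xS; rewrite -(mem_stable_porbit sA rx).
have /allP/(_ (b, r (porbit s x)))/= := EA; rewrite bA; move=> /(_ _)/eqP <- //.
by apply: map_f; rewrite mem_enum.
Qed.

(** The word is a geodesic of [s] followed by the squares of a star in each piece: the geodesic
    contributes the norm of the restriction to the weight, and each of the [k B] squares contributes
    2. *)
Lemma word_ex s (P : {set {set T}}) (k : {set T} -> nat) :
  partition P [set: T] -> {in P, forall B, stable s B} ->
  {in P, forall B, #|B| <= (perm_norm (restr_on B s) + k B).+1}%N ->
  {in P, forall B, #|B| = 1 -> k B = 0}%N ->
  exists w, [/\ wprod w = s, wparts w = P
    & {in P, forall B, cnt w B = (perm_norm (restr_on B s) + (k B).*2)%N}].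
Proof.
move=> partP sP leP P1; have [u gu us] := geodesicP s.
have uP B : B \in P -> clos u B by move=> BP; apply: geodesic_stable; rewrite ?us //; apply: sP.
have [P0 tP covP] : [/\ set0 \notin P, trivIset P & cover P = [set: T]].
  by case/and3P: partP => /eqP.
have /choice[F FP] : forall B : {set T}, exists E : seq (T * T), B \in P ->
    [/\ all (@dpair T) E, size E = k B,
      all (fun e => (e.1 \in B) && (e.2 \in B)) E
      & {in B &, forall x y, conn (u ++ E) x y}].
  move=> B; have [BP|_] := boolP (B \in P); last by exists [::].
  have [|||E EP] := @star_edges u B (k B) gu (uP B BP); last by exists E.
  - by apply: contraNneq P0 => <-.
  - by rewrite us leP.
  - exact: P1.
pose E := flatten [seq F B | B <- enum P].
have EP e : e \in E -> exists2 B, B \in P & e \in F B.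
  by case/flatten_mapP => B; rewrite mem_enum => BP eB; exists B.
have FE B : B \in P -> {subset F B <= E}.
  by move=> BP e eB; apply/flatten_mapP; exists B; rewrite ?mem_enum.
have PE B x : B \in P -> x \in B -> forall B', B' \in P -> (x \in B') = (B' == B).
  move=> BP xB B' BP'; apply/idP/eqP => [xB'|-> //].
  by rewrite -(def_pblock tP BP xB) (def_pblock tP BP' xB').
have EB B : B \in P -> clos E B.
  move=> BP; apply/allP => e /EP[B' BP' eB'].
  have [_ _ /allP/(_ e eB')/andP[e1 e2] _] := FP B' BP'.
  by rewrite (PE _ _ BP' e1 _ BP) (PE _ _ BP' e2 _ BP).
have cntE B : B \in P -> cnt E B = k B.
  move=> BP; rewrite /cnt count_flatten -map_comp sumnE big_map big_enum /=.
  rewrite (bigD1 B) //= big1 ?addn0 => [|B' /andP[BP' neB]].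
    have [dB <- inB _] := FP B BP; apply/eqP; rewrite -all_count; apply/allP => e eB.
    by have /= -> := allP dB e eB; have /andP[] := allP inB e eB.
  have [_ _ inB' _] := FP B' BP'; apply/eqP; rewrite -leqn0 leqNgt -has_count.
  apply/hasPn => e eB'; have /andP[e1 _] := allP inB' e eB'.
  by rewrite (PE _ _ BP' e1 _ BP) (eq_sym B) (negPf neB) andbF.
exists (u ++ dbl E); split.
- by rewrite wprod_cat wprod_dbl mulg1.
(* The block is closed, which bounds the component from above; the star connects the block, which
   bounds it from below. *)
- have compE x : component (u ++ dbl E) x = pblock P x.
    have xP : x \in cover P by rewrite covP inE.
    have BP := pblock_mem xP; have xB : x \in pblock P x by rewrite mem_pblock.
    apply/eqP; rewrite eqEsubset component_sub //=; last by rewrite clos_cat clos_dbl uP ?EB.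
    apply/subsetP => y yB; have [_ _ _ /(_ x y xB yB) xy] := FP _ BP.
    rewrite inE; apply: conn_sub xy => A; rewrite !clos_cat clos_dbl => /andP[-> /=].
    by move=> /allP EA; apply/allP => e /(FE _ BP)/EA.
  apply/setP => B; apply/mem_wparts/idP => [[x ->]|BP].
    by rewrite compE pblock_mem // covP inE.
  have /set0Pn[x xB] : B != set0 by apply: contraNneq P0 => <-.
  by exists x; rewrite compE (def_pblock tP BP xB).
by move=> B BP; rewrite cnt_cat cnt_dbl cntE // geodesic_cnt ?uP // us.
Qed.

End Realization.

(** * Weighted permutations as values of words *)

Section WeightedPermutations.
Variable d : nat.
Implicit Types (u v w : seq ('I_d * 'I_d)) (s : 'S_d) (x : wperm d).

Definition wval w : wperm d :=
  WPerm (wprod w) (wparts w)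
    [ffun B : {set 'I_d} => if B \in wparts w then cnt w B else 0%N].

Lemma same_wval u v : same u v -> wval u = wval v.
Proof.
case=> p c n; rewrite /wval p -(eq_wparts c); congr WPerm; apply/ffunP => B.
by rewrite !ffunE; case: ifP => // /wparts_clos/n.
Qed.

Lemma wval_same u v : wval u = wval v -> same u v.
Proof.
case=> p c /ffunP n; have cuv := wparts_eq c; split=> // A uA.
rewrite -(cnt_sum uA uA) c -(cnt_sum (w := v)) -?cuv //.
by apply: eq_bigr => B /andP[BP _]; have := n B; rewrite !ffunE c BP.
Qed.

(** The sets closed for [u ++ v] are those closed for both words. These are the sets that no path in
    [part_join] leaves, which reconciles cuts with paths. *)
Lemma wval_mul u v : wval (u ++ v) = wperm_mul (wval u) (wval v).
Proof.
have EJ : wparts (u ++ v) = part_join (wparts u) (wparts v).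
  rewrite /part_join /wparts; apply: eq_imset => i; apply/setP => j; rewrite !inE /=.
  set e := (X in connect X).
  apply/connP/idP => [|/connectP[p ep ->] A uvA].
    move/(_ [set k | connect e i k]); rewrite !inE connect0; apply=> //.
    have e_sym : symmetric e by move=> a b; rewrite /e /= !pblock_wparts !(conn_sym _ a).
    have step w : (forall a b, conn w a b -> e a b) -> clos w [set k | connect e i k].
      move=> we; apply/closP => a b /we eab; rewrite !inE; apply/idP/idP => ia.
        exact: connect_trans ia (connect1 eab).
      by apply: connect_trans ia (connect1 _); rewrite e_sym.
    by rewrite clos_cat !step // => a b ab; rewrite /e /= !pblock_wparts ab ?orbT.
  elim: p i ep => //= k p IHp i /andP[ik /IHp kp] iA; apply: kp.
  move: uvA ik; rewrite clos_cat /e /= !pblock_wparts => /andP[uA vA].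
  by case/orP => [/(clos_conn uA)|/(clos_conn vA)] <-.
rewrite /wval /wperm_mul /= wprod_cat EJ; congr WPerm; apply/ffunP => B.
rewrite !ffunE -EJ; case: ifP => // /wparts_clos; rewrite clos_cat => /andP[uB vB].
rewrite cnt_cat -(cnt_sum uB uB) -(cnt_sum vB vB).
by congr (_ + _)%N; apply: eq_bigr => A /andP[AP _]; rewrite ffunE AP.
Qed.

Lemma wval_conj u v : wval (wact u (wprod v)) = wperm_conj (wval u) (wval v).
Proof.
rewrite /wval /wperm_conj /= wprod_act wparts_act; congr WPerm.
apply/ffunP => B; rewrite !ffunE -wparts_act cnt_act.
suff -> : (B \in wparts (wact u (wprod v))) = ([set i | wprod v i \in B] \in wparts u) by [].
have EB : B = wprod v @: [set i | wprod v i \in B].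
  apply/setP => i; apply/idP/imsetP => [iB|[j]]; last by rewrite inE => jB ->.
  by exists ((wprod v)^-1 i); rewrite ?inE permKV.
rewrite {1}EB wparts_act mem_imset //; apply: imset_inj; exact: perm_inj.
Qed.

Lemma wval_geo u : geodesic u -> wval u = wperm_of (wprod u).
Proof.
move=> gu; have compE i : component u i = porbit (wprod u) i.
  apply/setP => j; rewrite inE; apply/connP/idP => [|ij A uA].
    by move/(_ (porbit (wprod u) i)); rewrite porbit_id geodesic_closE //; apply=> // ?;
      apply: stable_porbit.
  by rewrite (mem_stable_porbit (clos_stable uA) ij).
have EP : wparts u = porbits (wprod u).
  apply/setP => B; apply/mem_wparts/imsetP => [[i ->]|[i _ ->]]; exists i => //.
rewrite /wval /wperm_of EP; congr WPerm; apply/ffunP => B; rewrite !ffunE.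
case: ifP => // BP; have uB : clos u B by apply: wparts_clos; rewrite EP.
rewrite geodesic_cnt // -(perm_norm_restr_porbits (wprod u) B) card_porbits_restr;
  last exact: clos_stable.
suff -> : [set porbit (wprod u) i | i in B] = [set B] by rewrite cards1 addn1.
case/imsetP: BP => i _ ->; apply/setP => C; rewrite inE; apply/imsetP/eqP => [[j ji ->]|->].
  by apply/eqP; rewrite eq_porbit_mem.
by exists i; rewrite ?porbit_id.
Qed.

Lemma wval_admissible w : geo_admissible (wval w).
Proof.
apply/and5P; split.
- rewrite /weighted_partition /= wparts_partition /=.
  by apply/forallP => B; apply/implyP => /negPf nB; rewrite ffunE nB.
- apply/forall_inP => B /wparts_clos/clos_stable sB; apply/eqP; exact: stable_im.
- apply/forall_inP => B BP; rewrite ffunE BP.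
  have [k [-> lek]] := cnt_wparts BP; have := perm_norm_restr_porbits (wprod w) B; move: lek => /=.
  move: #|porbits _| #|B| (perm_norm _) => p b n; lia.
- apply/forall_inP => B BP; rewrite ffunE BP.
  by have [k [-> _]] := cnt_wparts BP; rewrite oddD odd_double addbF.
apply/forall_inP => B BP; apply/implyP => /eqP B1; rewrite ffunE BP.
by rewrite cnt_singleton.
Qed.

Lemma wval_surj x : geo_admissible x -> exists w, wval w = x.
Proof.
case: x => s P r /and5P[/andP[/= partP /forall_inP r0] /forall_inP sP /forall_inP boundP].
move=> /forall_inP oddP /forall_inP oneP.
have {}sP : {in P, forall B, stable s B} by move=> B /sP/eqP/im_stable.
pose n B := perm_norm (restr_on B s).
have rE B : B \in P -> (r B = n B + ((r B - n B)./2).*2)%N /\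
    (#|B| <= (n B + (r B - n B)./2).+1)%N.
  move=> BP; have := boundP B BP; have := perm_norm_restr_porbits s B; have := eqP (oddP B BP).
  (* Since a block contains a cycle, the weight bound forces [n B <= r B]: the truncated subtraction
     is exact, and parity makes the halving exact. *)
  have : (0 < #|porbits (restr_on B s)|)%N.
    have /set0Pn[i iB] : B != set0.
      by case/and3P: partP => _ _ P0; apply: contraNneq P0 => <-.
    by apply/card_gt0P; exists (porbit (restr_on B s) (exist _ i iB)); apply: imset_f.
  rewrite -/(n B) /=; move: #|porbits _| #|B| (n B) => p b m; lia.
have [w [ws wP wcnt]] : exists w, [/\ wprod w = s, wparts w = P
    & {in P, forall B, cnt w B = (n B + ((r B - n B)./2).*2)%N}].
  apply: word_ex => // B BP; first by have [] := rE B BP.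
  by move=> B1; have := oneP B BP; rewrite B1 => /eqP /= ->.
exists w; rewrite /wval ws wP; congr WPerm; apply/ffunP => B; rewrite ffunE.
case: ifP => [BP|/negbT BP]; first by rewrite wcnt //; have [<-] := rE B BP.
by have /eqP -> := r0 B BP.
Qed.

End WeightedPermutations.

(** * The completion and its universal property *)

Section Completion.
Variable d : nat.
Implicit Types (u v w : seq ('I_d * 'I_d)) (s : 'S_d) (a b c : geo_seq d).

Lemma geo_seq_inj a b : sval a = sval b -> a = b.
Proof. by case: a b => x xP [y yP] /= xy; apply: eq_exist. Qed.

Definition word_class w : geo_seq d := exist _ (wval w) (wval_admissible w).

Lemma word_class_surj a : exists w, word_class w = a.
Proof. by have [w wa] := wval_surj (svalP a); exists w; apply: geo_seq_inj. Qed.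

Lemma word_classP u v : word_class u = word_class v <-> hcong u v.
Proof.
split=> [/(congr1 sval) uv|/hcong_same/same_wval uv]; last exact: geo_seq_inj.
by apply: same_hcong; apply: wval_same.
Qed.

Fact geo_seq_mul_subproof a b : geo_admissible (wperm_mul (sval a) (sval b)).
Proof.
have [u <-] := word_class_surj a; have [v <-] := word_class_surj b.
by rewrite -wval_mul wval_admissible.
Qed.

Fact geo_seq_conj_subproof a b : geo_admissible (wperm_conj (sval a) (sval b)).
Proof.
have [u <-] := word_class_surj a; have [v <-] := word_class_surj b.
by rewrite -wval_conj wval_admissible.
Qed.

Definition geo_seq_mul a b : geo_seq d := 
  exist _ (wperm_mul (sval a) (sval b)) (geo_seq_mul_subproof a b).

Definition geo_seq_conj a b : geo_seq d := 
  exist _ (wperm_conj (sval a) (sval b)) (geo_seq_conj_subproof a b).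

Lemma geo_seq_mulE u v :
  geo_seq_mul (word_class u) (word_class v) = word_class (u ++ v).
Proof. by apply: geo_seq_inj; rewrite /= wval_mul. Qed.

Lemma geo_seq_conjE u v :
  geo_seq_conj (word_class u) (word_class v) = word_class (wact u (wprod v)).
Proof. by apply: geo_seq_inj; rewrite /= wval_conj. Qed.

Lemma wactM w s t : wact (wact w s) t = wact w (s * t).
Proof. by rewrite /wact -map_comp; apply: eq_map => e /=; rewrite edge_actM. Qed.

Lemma wact1 w : wact w 1 = w.
Proof. by rewrite /wact -[RHS]map_id; apply: eq_map => e; rewrite edge_act1. Qed.

Fact geo_seq_quandle : is_quandle (word_class [::]) geo_seq_conj.
Proof.
split=> [b|b|a|a|a b c].
(* Conjugation by a word depends only on its product, so a word with the inverse product gives the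
   inverse map. *)
- have [v <-] := word_class_surj b; have [v' _ vV] := geodesicP (wprod v)^-1.
  by exists (geo_seq_conj^~ (word_class v')) => a; have [u <-] := word_class_surj a;
    rewrite !geo_seq_conjE wactM vV ?mulgV ?mulVg wact1.
- by have [v <-] := word_class_surj b; rewrite geo_seq_conjE.
- by have [u <-] := word_class_surj a; rewrite geo_seq_conjE wprod_nil wact1.
- have [u <-] := word_class_surj a; rewrite geo_seq_conjE; apply: geo_seq_inj.
  exact/same_wval/same_act.
have [u <-] := word_class_surj a; have [v <-] := word_class_surj b.
have [w <-] := word_class_surj c; rewrite !geo_seq_conjE !wactM wprod_act.
by rewrite -conjgC.
Qed.

Fact geo_seq_pmonoid :
  is_pmonoid (word_class [::]) (fun a b => Some (geo_seq_mul a b)).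
Proof.
split=> [a|a|a b c] /=; congr Some.
- by have [u <-] := word_class_surj a; rewrite geo_seq_mulE.
- by have [u <-] := word_class_surj a; rewrite geo_seq_mulE cats0.
have [u <-] := word_class_surj a; have [v <-] := word_class_surj b.
by have [w <-] := word_class_surj c; rewrite !geo_seq_mulE catA.
Qed.

Fact geo_seq_mul_swap a b : Some (geo_seq_mul a b) = Some (geo_seq_mul b (geo_seq_conj a b)).
Proof.
have [u <-] := word_class_surj a; have [v <-] := word_class_surj b.
rewrite geo_seq_conjE !geo_seq_mulE; congr Some; apply: geo_seq_inj.
exact/same_wval/same_swap.
Qed.

Fact geo_seq_conj_mul a b c bc : Some (geo_seq_mul b c) = Some bc ->
  geo_seq_conj a bc = geo_seq_conj (geo_seq_conj a b) c.
Proof.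
case=> <-; have [u <-] := word_class_surj a; have [v <-] := word_class_surj b.
by have [w <-] := word_class_surj c; rewrite geo_seq_mulE !geo_seq_conjE wactM wprod_cat.
Qed.

Fact geo_seq_mul_conj a b c :
  Some (geo_seq_mul (geo_seq_conj a c) (geo_seq_conj b c)) =
    omap (geo_seq_conj^~ c) (Some (geo_seq_mul a b)).
Proof.
have [u <-] := word_class_surj a; have [v <-] := word_class_surj b.
have [w <-] := word_class_surj c; rewrite geo_seq_mulE /=.
by rewrite !geo_seq_conjE geo_seq_mulE /wact map_cat.
Qed.

Definition geo_completion : pmq :=
  PMQ geo_seq_quandle geo_seq_pmonoid geo_seq_mul_swap geo_seq_conj_mul geo_seq_mul_conj.

Lemma wperm_of_admissible s : geo_admissible (wperm_of s).
Proof. by have [u gu <-] := geodesicP s; rewrite -wval_geo // wval_admissible. Qed.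

Definition geo_seq_of s : geo_seq d := exist _ (wperm_of s) (wperm_of_admissible s).

Lemma geo_seq_ofE u : geodesic u -> geo_seq_of (wprod u) = word_class u.
Proof. by move=> gu; apply: geo_seq_inj; rewrite /= wval_geo. Qed.

Lemma geo_seq_of_map : @is_pmq_map (perm_geo 'I_d) geo_completion geo_seq_of.
Proof.
split=> /= [|s t|s t st].
- by rewrite -wprod_nil geo_seq_ofE // /geodesic wprod_nil perm_norm1.
- have [u gu <-] := geodesicP s; have [v gv <-] := geodesicP t.
  rewrite -wprod_act !geo_seq_ofE ?geo_seq_conjE //; exact: wact_geodesic.
rewrite /geo_mul; case: eqP => // + [<-].
have [u gu <-] := geodesicP s; have [v gv <-] := geodesicP t => uv.
rewrite -wprod_cat !geo_seq_ofE ?geo_seq_mulE // /geodesic wprod_cat uv size_cat.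
by rewrite (eqP gu) (eqP gv).
Qed.

Section Extension.
Variables (D : pmq) (g : perm_geo 'I_d -> D).
Hypotheses (D_complete : pmq_complete D) (g_map : is_pmq_map g).

Definition total_mul (x y : D) : D := sval (cid (D_complete x y)).

Lemma total_mulE x y : pmq_mul x y = Some (total_mul x y).
Proof. by rewrite /total_mul; case: cid. Qed.

Lemma total_mulA : associative total_mul.
Proof.
move=> x y z; have := pmonoid_assoc (pmq_pmonoid D) x y z.
by rewrite !total_mulE /= !total_mulE => -[].
Qed.

Lemma total_1mul : left_id (pmq_one D) total_mul.
Proof. by move=> x; have := pmonoid_1mul (pmq_pmonoid D) x; rewrite total_mulE => -[]. Qed.

Lemma total_mul1 : right_id (pmq_one D) total_mul.
Proof. by move=> x; have := pmonoid_mul1 (pmq_pmonoid D) x; rewrite total_mulE => -[]. Qed.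

Definition word_eval w : D :=
  foldr (fun e => total_mul (g (tperm e.1 e.2))) (pmq_one D) w.

Lemma word_eval_cat u v : word_eval (u ++ v) = total_mul (word_eval u) (word_eval v).
Proof. by elim: u => [|e u IHu] /=; rewrite ?total_1mul // IHu total_mulA. Qed.

Lemma word_eval_geo u : geodesic u -> word_eval u = g (wprod u).
Proof.
elim: u => [|e u IHu] gu /=; first by rewrite wprod_nil (pmq_map1 g_map).
have gu' : geodesic u by apply: (@geodesic_catr _ [:: e]).
rewrite IHu // wprod_cons; apply: Some_inj; rewrite -total_mulE.
apply: (pmq_mapM g_map); rewrite /= /geo_mul -wprod_cons.
have de : e.1 != e.2 by have /andP[] := geodesic_dpair gu.
by rewrite -(eqP gu) -(eqP gu') perm_norm_tperm // add1n eqxx.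
Qed.

(** A swap is the exchange law of [D], and a geodesic evaluates to the image of its product because
    its partial products are defined in [perm_geo]. *)
Lemma word_eval_hcong u v : hcong u v -> word_eval u = word_eval v.
Proof.
elim=> {u v} [|u v _ ->|v u w _ -> _ ->|u u' v v' _ uu' _ vv'|a b|u v gu gv uv|i] //.
- by rewrite !word_eval_cat uu' vv'.
- rewrite /= !total_mul1 -tpermJ; apply: Some_inj; rewrite -!total_mulE.
  by rewrite pmq_mul_swap -(pmq_mapJ g_map).
- by rewrite !word_eval_geo ?uv.
by rewrite /= tperm1 (pmq_map1 g_map) total_1mul.
Qed.

Lemma total_mul_conj x y z :
  pmq_conj (total_mul x y) z = total_mul (pmq_conj x z) (pmq_conj y z).
Proof. by have := pmq_mul_conj x y z; rewrite !total_mulE => -[]. Qed.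

Lemma word_eval_act1 w i j :
  word_eval (wact w (tperm i j)) = pmq_conj (word_eval w) (g (tperm i j)).
Proof.
elim: w => [|e w IHw] /=; first by rewrite (quandle_conj1 (pmq_quandle D)).
by rewrite IHw total_mul_conj -tpermJ (pmq_mapJ g_map).
Qed.

Lemma word_eval_act u v :
  word_eval (wact u (wprod v)) = pmq_conj (word_eval u) (word_eval v).
Proof.
elim: v u => [|e v IHv] u.
  by rewrite wprod_nil wact1 /= (quandle_1conj (pmq_quandle D)).
rewrite wprod_cons -wactM IHv word_eval_act1 /=.
by symmetry; apply: pmq_conj_mul; apply: total_mulE.
Qed.

Lemma geo_completion_init : exists h : geo_completion -> D,
  [/\ is_pmq_map h, h \o geo_seq_of =1 g
    & forall h' : geo_completion -> D, is_pmq_map h' -> h' \o geo_seq_of =1 g -> h' =1 h].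
Proof.
pose h a := word_eval (sval (cid (word_class_surj a))).
have hE w : h (word_class w) = word_eval w.
  by rewrite /h; case: cid => v /= /word_classP/word_eval_hcong.
have h_of s : h (geo_seq_of s) = g s.
  by have [u gu <-] := geodesicP s; rewrite geo_seq_ofE // hE word_eval_geo.
exists h; split=> //.
  split=> [|a b|a b ab].
  - exact: hE.
  - have [u <-] := word_class_surj a; have [v <-] := word_class_surj b.
    by rewrite /= geo_seq_conjE !hE word_eval_act.
  have [u <-] := word_class_surj a; have [v <-] := word_class_surj b.
  by case=> <-; rewrite geo_seq_mulE !hE word_eval_cat total_mulE.
move=> h' h'_map h'_of a; have [w <-] := word_class_surj a; rewrite hE.
elim: w => [|e w IHw]; first exact: (pmq_map1 h'_map).
apply: Some_inj; rewrite /= -total_mulE -IHw -h'_of /=.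
(* Prepending a letter is multiplication by the image of a transposition or of the unit, where [h']
   is prescribed. *)
suff -> : word_class (e :: w) = geo_seq_mul (geo_seq_of (tperm e.1 e.2)) (word_class w).
  by symmetry; apply: (pmq_mapM h'_map).
have -> : geo_seq_of (tperm e.1 e.2) = word_class [:: e].
  have [e12|de] := eqVneq e.1 e.2; last first.
    by rewrite -wprod1 geo_seq_ofE // /geodesic wprod1 perm_norm_tperm.
  rewrite e12 tperm1 -wprod_nil geo_seq_ofE; last by rewrite /geodesic wprod_nil perm_norm1.
  apply/word_classP/hcong_sym; rewrite [e]surjective_pairing e12; exact: hcong_loop.
by rewrite geo_seq_mulE.
Qed.

End Extension.

Lemma geo_completionP : @is_completion (perm_geo 'I_d) geo_completion geo_seq_of.
Proof.
split; first by move=> a b; exists (geo_seq_mul a b).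
  exact: geo_seq_of_map.
exact: geo_completion_init.
Qed.

End Completion.

(** * The enveloping group of a PMQ *)

Section Enveloping.
Variable Q : pmq.
Implicit Types (a b c : Q) (x y : enveloping Q).

Lemma env_classM u v :
  env_class (u ++ v) = env_class u * env_class v :> enveloping Q.
Proof. exact: env_class_cat. Qed.

Lemma env_class_neg a : env_class [:: (a, true)] = (env_gen a)^-1 :> enveloping Q.
Proof.
apply: (mulgI (env_gen a)); rewrite mulgV -env_classM.
by apply/env_classP; apply: env_cancel.
Qed.

Lemma env_genJ a b : env_gen a ^ env_gen b = env_gen (pmq_conj a b).
Proof.
rewrite conjgE -env_class_neg -(env_classM [:: (a, false)]) -env_classM.
by apply/env_classP; apply: env_conj.
Qed.

Lemma env_genM a b c : pmq_mul a b = Some c -> env_gen a * env_gen b = env_gen c.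
Proof.
by move=> abc; rewrite /env_gen -env_classM; apply/env_classP; apply: env_mul.
Qed.

Lemma env_gen1 : env_gen (pmq_one Q) = 1.
Proof.
apply: (mulgI (env_gen (pmq_one Q))); rewrite mulg1; apply: env_genM.
exact: pmonoid_1mul (pmq_pmonoid Q) _.
Qed.

Lemma env_ind (P : enveloping Q -> Prop) : P 1 ->
  (forall x a, P x -> P (env_gen a * x)) ->
  (forall x a, P x -> P ((env_gen a)^-1 * x)) -> forall x, P x.
Proof.
move=> P1 Pp Pn x; rewrite -[x]env_classK; elim: (generic_quotient.repr x) => //.
move=> [a b] w Pw; rewrite -cat1s env_classM.
by case: b; rewrite ?env_class_neg; [apply: Pn | apply: Pp].
Qed.

Lemma env_lift (H : groupType) (f : Q -> H) :
  (forall a b, f a ^ f b = f (pmq_conj a b)) ->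
  (forall a b c, pmq_mul a b = Some c -> f a * f b = f c) ->
  exists2 phi : enveloping Q -> H, {morph phi : x y / x * y} &
    forall a, phi (env_gen a) = f a.
Proof.
move=> fJ fM.
pose ev (w : seq (Q * bool)) :=
  foldr (fun l h => (if l.2 then (f l.1)^-1 else f l.1) * h) 1 w.
have ev_cat u v : ev (u ++ v) = ev u * ev v.
  by elim: u => [|l u IHu] /=; rewrite ?mul1g // IHu mulgA.
have ev_cong u v : env_cong u v -> ev u = ev v.
  elim=> {u v} [|u v _ ->|u v w _ -> _ ->|u u' v v' _ uu' _ vv'|a []|a b|a b c abc] //=.
  - by rewrite !ev_cat uu' vv'.
  - by rewrite mulg1 mulVg.
  - by rewrite mulg1 mulgV.
  - by rewrite !mulg1 -conjgE fJ.
  by rewrite !mulg1; apply: fM.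
have evE u : ev (generic_quotient.repr (env_class u)) = ev u by apply/ev_cong/env_repr_class.
exists (fun x => ev (generic_quotient.repr x)) => [x y|a]; last by rewrite evE /= mulg1.
by rewrite -[in LHS](env_classK x) -[in LHS](env_classK y) -env_classM evE ev_cat.
Qed.

End Enveloping.

(** * The enveloping group of the geodesic permutations *)

Section EnvelopingPerm.
Variable d : nat.
Hypothesis d_ge2 : (2 <= d)%N.
Implicit Types (s t : 'S_d) (i j : 'I_d).

Let G : groupType := enveloping (perm_geo 'I_d).

Definition perm_gen s : G := env_gen (s : perm_geo 'I_d).

Lemma perm_genJ s t : perm_gen s ^ perm_gen t = perm_gen (s ^ t).
Proof. exact: env_genJ. Qed.

Lemma perm_genM s t : perm_norm (s * t) = (perm_norm s + perm_norm t)%N ->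
  perm_gen (s * t) = perm_gen s * perm_gen t.
Proof. by move=> st; symmetry; apply: env_genM; rewrite /= /geo_mul st eqxx. Qed.

Let i0 : 'I_d := Ordinal (ltnW d_ge2).
Let i1 : 'I_d := Ordinal d_ge2.

Definition tperm_sq : G := perm_gen (tperm i0 i1) * perm_gen (tperm i0 i1).

Lemma perm_genC s t : perm_gen s * perm_gen t = perm_gen t * perm_gen (s ^ t).
Proof. by rewrite conjgC perm_genJ. Qed.

Lemma tperm_sq_gen s : commute tperm_sq (perm_gen s).
Proof.
symmetry; rewrite /tperm_sq mulgA (perm_genC s) -[LHS]mulgA (perm_genC (s ^ _)) -conjgM tperm2 conjg1.
exact: mulgA.
Qed.

Lemma tperm_sq_central (x : G) : commute tperm_sq x.
Proof.
elim/env_ind: x => [|x s Cx|x s Cx]; first exact: commute1.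
  by apply: commuteM => //; apply: tperm_sq_gen.
by apply: commuteM => //; apply/commuteV/tperm_sq_gen.
Qed.

(** All transpositions are conjugate, hence so are their squares; being central, [tperm_sq] equals
    its conjugates. *)
Lemma perm_gen_sq i j : i != j -> perm_gen (tperm i j) * perm_gen (tperm i j) = tperm_sq.
Proof.
move=> ij; have i01 : i0 != i1 by [].
pose p := tperm i0 i * tperm (tperm i0 i i1) j.
have -> : tperm i j = tperm i0 i1 ^ p.
  by rewrite tpermJ; have [-> ->] := tperm_pair_ex i01 ij.
by rewrite -perm_genJ -conjMg -/tperm_sq conjgE tperm_sq_gen mulKg.
Qed.

Lemma perm_gen1 : perm_gen 1 = 1.
Proof. exact: env_gen1. Qed.

Lemma perm_gen_geodesic u : geodesic u ->
  perm_gen (wprod u) = \prod_(e <- u) perm_gen (tperm e.1 e.2).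
Proof.
elim: u => [|e u IHu] gu; first by rewrite wprod_nil big_nil perm_gen1.
have gu' : geodesic u by apply: (@geodesic_catr _ [:: e]).
rewrite big_cons -IHu // wprod_cons perm_genM //.
have de : e.1 != e.2 by have /andP[] := geodesic_dpair gu.
by rewrite -wprod_cons -(eqP gu) -(eqP gu') perm_norm_tperm.
Qed.

Lemma perm_gen_tpermM s i j : i != j ->
  exists n, perm_gen (tperm i j) * perm_gen s = perm_gen (tperm i j * s) * tperm_sq ^+ n.
Proof.
move=> ij; have [s_ij|s_ij] := boolP (i \in porbit s j).
  exists 1%N; have {1}-> : s = tperm i j * (tperm i j * s) by rewrite mulgA tperm2 mul1g.
  rewrite [perm_gen (tperm i j * (_ * _))]perm_genM; first by rewrite mulgA perm_gen_sq // tperm_sq_gen.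
  by rewrite perm_norm_tpermM // porbit_tpermM // s_ij perm_norm_tperm.
exists 0%N; rewrite mulg1 perm_genM // perm_norm_tpermM // (negPf s_ij).
by rewrite perm_norm_tperm.
Qed.

(** The exponent of the central square may be negative and is recorded as the difference [n - m] of
    natural numbers. *)
Lemma env_normal (x : G) : exists s m n, x * tperm_sq ^+ m = perm_gen s * tperm_sq ^+ n.
Proof.
pose P (x : G) := exists s m n, x * tperm_sq ^+ m = perm_gen s * tperm_sq ^+ n.
have Pt y i j : i != j -> P y -> P (perm_gen (tperm i j) * y).
  move=> ij [s [m [n ys]]]; have [k eq_k] := perm_gen_tpermM s ij.
  by exists (tperm i j * s), m, (k + n)%N; rewrite -mulgA ys mulgA eq_k -mulgA expgnDr.
have Pz y : P (y * tperm_sq) -> P y.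
  by case=> [s [m [n ys]]]; exists s, m.+1, n; rewrite expgS mulgA.
have Pt' y i j : i != j -> P y -> P ((perm_gen (tperm i j))^-1 * y).
  (* An inverse transposition is the transposition divided by [tperm_sq]; raising [m] by 1 absorbs
     the division. *)
  move=> ij Py; apply: Pz; suff -> : (perm_gen (tperm i j))^-1 * y * tperm_sq = perm_gen (tperm i j) * y.
    exact: Pt.
  by rewrite -mulgA -tperm_sq_central -(perm_gen_sq ij) !mulgA mulVg mul1g.
elim/env_ind: x => [|x s Px|x s Px].
- by exists 1, 0%N, 0%N; rewrite perm_gen1.
- have [u gu <-] := geodesicP s; rewrite -/(P _) -/(perm_gen _) perm_gen_geodesic //.
  elim: u {gu} (geodesic_dpair gu) x Px => [_ x Px|e u IHu /= /andP[de du] x Px];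
    first by rewrite big_nil mul1g.
  by rewrite big_cons -mulgA; apply: Pt de _; apply: IHu.
have [u gu <-] := geodesicP s; rewrite -/(P _) -/(perm_gen _) perm_gen_geodesic //.
elim: u {gu} (geodesic_dpair gu) x Px => [_ x Px|e u IHu /= /andP[de du] x Px];
    first by rewrite big_nil invg1 mul1g.
by rewrite big_cons invgM -mulgA; apply: IHu; last exact: Pt'.
Qed.

Definition norm_pair s : multZ * 'S_d := (Posz (perm_norm s), s).

Lemma env_to_pair : exists2 phi : G -> multZ * 'S_d,
  {morph phi : x y / x * y} & forall s, phi (perm_gen s) = norm_pair s.
Proof.
apply: env_lift => [s t|s t st] /=.
  rewrite conjgE; congr (_, _); rewrite /= ?perm_normJ //.
  suff : (- Posz (perm_norm t) + (Posz (perm_norm s) + Posz (perm_norm t)) =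
    Posz (perm_norm s))%R by [].
  lia.
by rewrite /geo_mul; case: eqP => // e [<-]; congr (_, _); rewrite /= e.
Qed.

Section Morphism.
Variable phi : G -> multZ * 'S_d.
Hypotheses (phiM : {morph phi : x y / x * y}) (phi_gen : forall s, phi (perm_gen s) = norm_pair s).

Lemma phi_tperm_sqX n : phi (tperm_sq ^+ n) = (Posz n.*2, 1).
Proof.
have phi_z : phi tperm_sq = (Posz 2, 1).
  by rewrite phiM phi_gen; congr (_, _); rewrite /= ?tperm2 // perm_norm_tperm.
elim: n => [|n IHn]; first by rewrite expg0 -[X in phi X]perm_gen1 phi_gen /norm_pair perm_norm1.
by rewrite expgS phiM phi_z IHn; congr (_, _); rewrite /= mulg1.
Qed.

(** The image under [phi] determines [s] and [n - m] in the normal form; this yields both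
    injectivity and the parity constraint. *)
Lemma phi_spec x : exists m n, x * tperm_sq ^+ m = perm_gen (phi x).2 * tperm_sq ^+ n /\
  ((phi x).1 + Posz m.*2 = Posz (perm_norm (phi x).2) + Posz n.*2)%R.
Proof.
have [s [m [n xs]]] := env_normal x; exists m, n.
have := congr1 phi xs; rewrite !phiM !phi_tperm_sqX phi_gen => -[e1 e2].
by rewrite !mulg1 in e2; rewrite e2; split.
Qed.

Lemma phi_inj : injective phi.
Proof.
move=> x y xy; have [m [n [xs ex]]] := phi_spec x; have [m' [n' [ys ey]]] := phi_spec y.
have mn : (n + m' = n' + m)%N by move: ex ey; rewrite xy; lia.
apply: (mulIg (tperm_sq ^+ (m + m'))); rewrite {2}addnC !expgnDr !mulgA xs ys xy.
by rewrite -!mulgA -!expgnDr mn.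
Qed.

Lemma phi_image g : same_parity g <-> exists x, phi x = g.
Proof.
split=> [|[x <-]]; last first.
  have [m [n [_ ex]]] := phi_spec x; apply/eqP; lia.
case: g => r s /eqP /= rs.
have [m [n e]] : exists m n : nat, (r + Posz m.*2 = Posz (perm_norm s) + Posz n.*2)%R.
  (* The choice of [m] keeps [2n = r + 2m - N(s)] nonnegative, and equal parities make the half
     exact. *)
  exists (absz r + perm_norm s)%N, (absz (r + (absz r).*2 + perm_norm s)%R)./2.
  move: (perm_norm s) rs => k; lia.
exists (perm_gen s * tperm_sq ^+ n * (tperm_sq ^+ m)^-1); apply: (mulIg (phi (tperm_sq ^+ m))).
rewrite -phiM mulgKV phiM !phi_tperm_sqX phi_gen; by congr (_, _); rewrite /= ?mulg1.
Qed.

End Morphism.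

Lemma same_parity_index2 : index2_subgroup (@same_parity d).
Proof.
(* The subgroup is the kernel of [par], a homomorphism onto the group of order 2. *)
pose par (g : multZ * 'S_d) := odd (absz g.1) (+) odd_perm g.2.
have HE g : same_parity g = ~~ par g.
  by rewrite /same_parity odd_perm_norm /par; case: (odd _); case: (odd_perm _).
have parV g : par g^-1 = par g.
  rewrite /par odd_permV; congr (_ (+) _); case: g => r s /=.
  suff : odd (absz (- r)%R) = odd (absz r) by []. lia.
have parM g h : par (g * h) = par g (+) par h.
  rewrite /par odd_permM addbACA; congr (_ (+) _); case: g h => r s [r' s'] /=.
  suff : odd (absz (r + r')%R) = odd (absz r) (+) odd (absz r') by []. lia.
split.
- split=> [|g h gH hH]; apply: etrans (HE _) _; first by rewrite /par odd_perm1.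
  by move: (gH) (hH) => /(etrans (esym (HE g)))/negPf eg /(etrans (esym (HE h)))/negPf eh;
    rewrite parM parV eg eh.
- by exists (Posz 1, 1); rewrite HE /par odd_perm1.
by move=> g h; rewrite !HE !negbK parM parV => -> ->.
Qed.

End EnvelopingPerm.

Theorem theorem10 (d : nat) (d_ge2 : (2 <= d)%N) :
  (index2_subgroup (@same_parity d) /\
   exists phi : enveloping (perm_geo 'I_d) -> (multZ * 'S_d)%type,
     [/\ {morph phi : x y / (x * y)%g >-> (x * y)%g},
         injective phi,
         forall g, same_parity g <-> exists x, phi x = g
       & forall s : 'S_d,
           phi (env_gen (s : perm_geo 'I_d)) = (Posz (perm_norm s), s)]) /\
  (exists (C : pmq) (i : perm_geo 'I_d -> C), is_completion i /\
    exists phi : C -> geo_seq d,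
      [/\ bijective phi,
          forall s : 'S_d, sval (phi (i s)) = wperm_of s,
          forall a b ab, pmq_mul a b = Some ab ->
            sval (phi ab) = wperm_mul (sval (phi a)) (sval (phi b))
        & forall a b,
            sval (phi (pmq_conj a b))
              = wperm_conj (sval (phi a)) (sval (phi b))]).
Proof.
split; last first.
  exists (geo_completion d), (@geo_seq_of d); split; first exact: geo_completionP.
  exists id; split=> // [|a b ab [<-] //]; by exists id.
split; first exact: same_parity_index2.
have [phi phiM phi_gen] := env_to_pair d_ge2; exists phi; split=> //.
- exact: (phi_inj d_ge2 phiM phi_gen).
- exact: (phi_image d_ge2 phiM phi_gen).
Qed.
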